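(* Let $T$ be a tree and let $I=I(T)\subset R=K[x_1,\dots,x_n]$ be its edge ideal. The cellular resolution $(F_r,\partial_r)$ (where $F_r$ is the free $R$-module on the $F$-admissible symbols of length $r$, and $\partial_r:F_r\to F_{r-1}$ is the differential given in the context) is a minimal graded free resolution of $R/I$.
   Context: Setting. $T$ is a finite tree on the vertex set $\{x_1,\dots,x_n\}$, $K$ is a field, $R=K[x_1,\dots,x_n]$, and $I=I(T)$ is the ideal generated by the edge monomials $x_ix_j$ with $\{x_i,x_j\}$ an edge of $T$ (edges are identified with their monomials). The vertex $x_1$ is fixed as root. The vertices at distance $i$ from $x_1$ (vertices of rank $i$) are listed as $x_1^{(i)},\dots,x_{s_i}^{(i)}$; so $x_1^{(0)}=x_1$. The indeterminates are ordered by $x_1^{(0)}>x_1^{(1)}>\cdots>x_{s_1}^{(1)}>x_1^{(2)}>\cdots>x_{s_2}^{(2)}>\cdots$, the indices $(i)_p$ of the vertices $x^{(i)}_p$ are ordered in the same way, and monomials are ordered by the induced lexicographic order. $S$ is the sequence of all edge monomials of $T$ in decreasing order. Symbols. A symbol is a subsequence $u=(\mu_1,\dots,\mu_r)$ of $S$ (treated as an ordered set; the empty symbol is the only one of length $0$); $|u|=r$ is its length; a subsymbol is a subsequence of $u$; $\mathrm{lcm}(u)=\mathrm{lcm}(\mu_1,\dots,\mu_r)$. The grade $\mathrm{gr}(u)\in\mathbb{Z}^n$ is the exponent vector of $\mathrm{lcm}(u)$; the free generator $u$ is placed in multidegree $\mathrm{gr}(u)$. Gaps and bridges. Let $x,y,z,w$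 be four distinct vertices with $xy,zw\in u$, $xy>zw$ and $xz\in I$. Then $xz$ is the bridge between $xy$ and $zw$. The monomials $xy$ and $zw$ form a gap in $u$ (with bridge $xz$) if $xz\notin u$, no monomial of $u$ other than $zw$ is divisible by $w$, and no monomial of $u$ smaller than $zw$ is divisible by $y$. A symbol $u$ contains a bridge (namely $xz$, called a bridge of $u$) if it contains three monomials $xy,zw,xz$ with $x,y,z,w$ distinct. $F$-admissible symbols. For each vertex $x^{(i)}_p$ let $K^{(i)}_p$ be the set of edges of $T$ containing $x^{(i)}_p$. $F$-admissible symbols are those produced as follows. (I) Select a descending sequence of indices $(i_1)_{p_1},\dots,(i_t)_{p_t}$ not containing any pair of indices corresponding to adjacent vertices of $T$. (II) Take all edge monomials in $K^{(i_1)}_{p_1},\dots,K^{(i_t)}_{p_t}$. (III) In the resulting symbol, cancel every monomial $\mu$ such that $\mu\in K^{(i_h)}_{p_h}$ for some $h$ and $\mu$ is not coprime to an element $\nu$ of the symbol with $\nu\in K^{(i_k)}_{p_k}$ for some $k>h$. (IV) Take all subsymbols of the symbols obtained. (V) Discard all symbols that contain a gap. The matching $A$. Let $X$ be the Taylor complex of $I$, viewed as a $\mathbb{Z}^n$-graded CW-complex whose cells are all symbols $u$ (with dimension indexed by the length) graded by $\mathrm{gr}$. Let $G_X$ be the directed graph on the symbols with edge set $E_X$ consisting of all $u\to u'$ with $u'\subset u$ and $|u|=|u'|+1$. A bridge $\lambda$ of $u$ follows a gap of $u$ with bridge $xz$ if $xz>\lambda$. A symbol is of type 1 if it contains a gap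 that is not followed by any bridge. Let $A\subseteq E_X$ be the set of edges $u\to u'$ such that $u'$ is of type 1 and $u$ is obtained from $u'$ by inserting the smallest among the bridges of the gaps of $u'$. Let $G_X^A$ be the directed graph on the symbols with edge set $(E_X\setminus A)\cup\{u'\to u : (u\to u')\in A\}$. The complex $(F_r,\partial_r)$ is the cellular complex supported on the Morse complex obtained from $X$ and $A$ by discrete Morse theory (Batzies–Welker), whose cells correspond to the symbols not occurring in any edge of $A$, i.e. to the $F$-admissible symbols. The differential. For symbols $u=(\mu_{i_1},\dots,\mu_{i_r})$ and $u'=(\mu_{i_1},\dots,\widehat{\mu_{i_j}},\dots,\mu_{i_r})$ let $[u:u']=(-1)^{j+1}$. For $u\to u'$ in $E_X$ put $m(\{u,u'\})=-[u:u']$ if $(u\to u')\in A$ and $m(\{u,u'\})=[u:u']$ otherwise. A gradient path from $u_0$ to $u_t$ is a directed path $P:u_0\to u_1\to\cdots\to u_t$ in $G^A_X$ (with $t\ge 0$), and $m(P)=\prod_{i=0}^{t-1}m(\{u_i,u_{i+1}\})$. For every $F$-admissible symbol $u$ of length $r$, $$\partial_r(u)=\sum_{\substack{u'\subset u\\ |u'|=r-1}}[u:u']\sum_{\substack{u''\ F\text{-admissible}\\ |u''|=r-1}}\ \sum_{\substack{P\text{ gradient path}\\ \text{from }u'\text{ to }u''}}m(P)\,\underline{x}^{\mathrm{gr}(u)-\mathrm{gr}(u'')}\,u''.$$ Here $F_0=R$ is generated by the empty symbol. *)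

(* Defs.v *)
From HB Require Import structures.
From mathcomp Require Import all_boot all_order all_algebra.
From mathcomp Require Export mpoly.

Set Implicit Arguments.
Unset Strict Implicit.
Unset Printing Implicit Defensive.

Import GRing.Theory.
Local Open Scope ring_scope.

(* Multigraded based free complexes over R = K[x_1, ..., x_n]: the module F_r *)
(* is {ffun B r -> R}, free on the finite set B r, and a map between free     *)
(* modules is given by the images of the basis elements, M u being            *)
(* \sum_v M u v * v.                                                          *)
Section Resolutions.

Context (n : nat) (K : fieldType).
Local Notation R := {mpoly K[n]}.

Definition ideal_gen (J : finType) (g : J -> R) (p : R) : Prop :=
  exists c : J -> R, p = \sum_j c j * g j.

Definition max_ideal : R -> Prop := ideal_gen (fun i : 'I_n => 'X_i).

Definition free_map (B C : finType) (M : B -> C -> R) (f : {ffun B -> R}) :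
    {ffun C -> R} :=
  [ffun v => \sum_u f u * M u v].

Definition free_aug (B : finType) (eps : B -> R) (f : {ffun B -> R}) : R :=
  \sum_u f u * eps u.

(* f is homogeneous of multidegree a when u is placed in multidegree deg u.   *)
Definition homogeneous (B : finType) (deg : B -> 'X_{1..n}) (a : 'X_{1..n})
    (f : {ffun B -> R}) : Prop :=
  forall (u : B) (m : 'X_{1..n}), m \in msupp (f u) -> (m + deg u)%MM = a.

(* Here d r is the differential F_{r+1} -> F_r, and the augmentation          *)
(* F_0 -> R/I is f |-> free_aug eps f modulo I.                               *)
Record minimal_graded_free_resolution_of_quotient (I : R -> Prop)
    (B : nat -> finType) (deg : forall r, B r -> 'X_{1..n})
    (d : forall r, B r.+1 -> B r -> R) (eps : B 0 -> R) : Prop := {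
  res_aug_surjective : forall p : R, exists f, I (p - free_aug eps f);
  res_exact0 : forall f : {ffun B 0 -> R},
    I (free_aug eps f) <-> exists g, f = free_map (d 0) g;
  res_exact : forall r (f : {ffun B r.+1 -> R}),
    free_map (d r) f = 0 <-> exists g, f = free_map (d r.+1) g;
  res_aug_graded : forall a f, homogeneous (deg 0) a f ->
    forall m, m \in msupp (free_aug eps f) -> m = a;
  res_graded : forall r a f, homogeneous (deg r.+1) a f ->
    homogeneous (deg r) a (free_map (d r) f);
  res_minimal : forall r (f : {ffun B r.+1 -> R}) (v : B r),
    max_ideal (free_map (d r) f v)
}.

End Resolutions.

Section Trees.

Context (n : nat) (T : rel 'I_n).

Definition is_tree : Prop :=
  [/\ ssrbool.symmetric T, irreflexive T, (forall x y, connect T x y)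
    & forall c : seq 'I_n, ucycle T c -> (size c <= 2)%N].

(* Length of a shortest walk from x to y (it is n if there is none).          *)
Definition dist (x y : 'I_n) : nat :=
  find (fun k => [exists p : k.-tuple 'I_n, path T x p && (last x p == y)])
       (iota 0 n).

(* s lists the vertices rank by rank from the root r, in an arbitrary order   *)
(* inside each rank.                                                          *)
Definition rank_listing (r : 'I_n) (s : seq 'I_n) : Prop :=
  perm_eq s (enum 'I_n) /\ sorted (fun x y => (dist r x <= dist r y)%N) s.

Definition edges : {set {set 'I_n}} :=
  [set mu : {set 'I_n} | [exists x, exists y, T x y && (mu == [set x; y])]].

Definition edge_mon (mu : {set 'I_n}) : 'X_{1..n} :=
  [multinom (i \in mu : nat) | i < n].

Definition edge_ideal (K : fieldType) : {mpoly K[n]} -> Prop :=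
  ideal_gen (fun mu : {mu | mu \in edges} => 'X_[K, edge_mon (val mu)]).

End Trees.

(* An edge is the set of its two endpoints: i divides mu iff i \in mu, and    *)
(* two edges are coprime iff they are disjoint.                               *)
Section EdgeIdealComplex.

Context (n : nat) (T : rel 'I_n) (s : seq 'I_n).

Local Notation edge := {set 'I_n}.
Local Notation symb := {set {set 'I_n}}.

(* The indeterminates decrease along s.                                       *)
Definition vgt (x y : 'I_n) : bool := (index x s < index y s)%N.

Definition lexgt (m1 m2 : 'X_{1..n}) : bool :=
  [exists i, (m2 i < m1 i)%N && [forall j, vgt j i ==> (m1 j == m2 j)]].

Definition egt (mu nu : edge) : bool := lexgt (edge_mon mu) (edge_mon nu).
Definition ege (mu nu : edge) : bool := (mu == nu) || egt mu nu.

Definition edge_seq : seq edge := sort ege (enum (edges T)).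

(* A symbol is encoded by the set of its members; the subsequence of edge_seq *)
(* it stands for is symb_seq.                                                 *)
Definition is_symbol (u : symb) : bool := u \subset edges T.
Definition symb_seq (u : symb) : seq edge := [seq mu <- edge_seq | mu \in u].

Definition gr (u : symb) : 'X_{1..n} :=
  \big[@mlcm n/0%MM]_(mu in u) edge_mon mu.

(* xy and zw form a gap in u, with bridge xz.                                 *)
Definition is_gap (u : symb) (x y z w : 'I_n) : bool :=
  [&& uniq [:: x; y; z; w],
      [set x; y] \in u, [set z; w] \in u, egt [set x; y] [set z; w],
      T x z, [set x; z] \notin u,
      [forall mu in u, (w \in mu) ==> (mu == [set z; w])]
    & [forall mu in u, egt [set z; w] mu ==> (y \notin mu)]].

Definition gap_bridges (u : symb) : {set edge} :=
  [set mu : edge | [exists x, exists y, exists z, exists w,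
     is_gap u x y z w && (mu == [set x; z])]].

Definition has_gap (u : symb) : bool :=
  [exists x, exists y, exists z, exists w, is_gap u x y z w].

Definition bridges (u : symb) : {set edge} :=
  [set mu : edge | [exists x, exists y, exists z, exists w,
     [&& uniq [:: x; y; z; w], [set x; y] \in u, [set z; w] \in u,
         [set x; z] \in u & mu == [set x; z]]]].

Definition type1 (u : symb) : bool :=
  [exists x, exists y, exists z, exists w, is_gap u x y z w &&
     [forall la in bridges u, ~~ egt [set x; z] la]].

(* The edges containing the vertex x.                                         *)
Definition star (x : 'I_n) : {set edge} := [set mu in edges T | x \in mu].

(* A descending sequence of indices is encoded by the set of its members.     *)
Definition selectable (W : {set 'I_n}) : bool :=
  [forall x in W, forall y in W, ~~ T x y].

Definition selected (W : {set 'I_n}) : symb := \bigcup_(x in W) star x.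

Definition pruned (W : {set 'I_n}) : symb :=
  [set mu in selected W |
     ~~ [exists x in W, exists y in W,
           [&& mu \in star x, vgt x y
             & [exists nu in star y, ~~ [disjoint mu & nu]]]]].

Definition F_admissible (u : symb) : bool :=
  [exists W : {set 'I_n}, selectable W && (u \subset pruned W)] && ~~ has_gap u.

Definition facet (u u' : symb) : bool :=
  [&& is_symbol u, is_symbol u', u' \subset u & #|u| == #|u'|.+1].

(* For a facet u' of u, (-1)^(j+1) where the member of u that is missing from *)
(* u' is the j-th one (j >= 1).                                               *)
Definition incidence (u u' : symb) : int :=
  let j := (find (fun mu => mu \notin u') (symb_seq u)).+1 in (-1) ^+ j.+1.

Definition matching (u u' : symb) : bool :=
  [&& facet u u', type1 u' &
      [exists mu in gap_bridges u',
         [forall nu in gap_bridges u', ege nu mu] && (u == mu |: u')]].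

(* The edges a -> b of the graph G_X^A, and their weights m({a, b}).          *)
Definition grad_step (a b : symb) : bool :=
  (facet a b && ~~ matching a b) || matching b a.

Definition step_weight (a b : symb) : int :=
  if matching b a then - incidence b a else incidence a b.

Fixpoint path_weight (a : symb) (p : seq symb) : int :=
  if p is b :: p' then step_weight a b * path_weight b p' else 1.

(* The sum of m(P) over all gradient paths P from a to b. As G_X^A is         *)
(* acyclic, no path visits a symbol twice, so that the length t of a path is  *)
(* smaller than the number of symbols and the bound below discards nothing.   *)
Definition grad_path_sum (a b : symb) : int :=
  \sum_(t < #|{: symb}|)
    \sum_(p : t.-tuple symb | path grad_step a p && (last a p == b))
      path_weight a p.

Definition morse_coef (u u'' : symb) : int :=
  \sum_(u' | facet u u') incidence u u' * grad_path_sum u' u''.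

(* The basis of F_r.                                                          *)
Definition F_basis (r : nat) : finType :=
  {u : symb | F_admissible u && (#|u| == r)}.

Definition F_deg (r : nat) (u : F_basis r) : 'X_{1..n} := gr (val u).

(* The subtraction of multinomials is truncated, but gr cannot increase along *)
(* a gradient path: if gr u'' does not divide gr u, then morse_coef is 0.     *)
Definition F_diff (K : fieldType) (r : nat) (u : F_basis r.+1)
    (u'' : F_basis r) : {mpoly K[n]} :=
  (morse_coef (val u) (val u''))%:~R * 'X_[gr (val u) - gr (val u'')].

(* F_0 is identified with R by sending the empty symbol to 1.                 *)
Definition F_aug (K : fieldType) (u : F_basis 0) : {mpoly K[n]} := 1.

End EdgeIdealComplex.

(* Main.v *)
Require Import Defs.
From mathcomp Require Import all_boot all_order all_algebra.
From mathcomp Require Import zify.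

Set Implicit Arguments.
Unset Strict Implicit.
Unset Printing Implicit Defensive.

(** Over the polynomial ring the Taylor complex of the edge ideal is exact: in
    multidegree a it is the augmented chain complex of the full simplex on the
    edges dividing a, a cone as soon as one edge divides a ([taylor_exact]).  The
    complex F arises from it by cancelling the pairs of symbols matched by A.
    So one has to understand A, to show that the cancellation keeps exactness,
    and to see that what remains is minimal.

    The combinatorics rests on one fact about the ordering of the vertices: a
    vertex has at most one earlier neighbour, its parent ([parent_unique]).  In a
    gap, and in a bridge, the edge in the middle goes from a parent x to a child
    z, and the path y - x - z - w around it ends in a child w of z.  Call {x, z}
    toggleable in u when u has all that makes {x, z} the bridge of a gap, except
    that {x, z} itself may belong to u or not.  Insertion or removal of {x, z}
    does not affect this, and the smallest bridge of a symbol is toggleable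
    ([bridge_toggleable]).  Therefore A pairs u with the symbol obtained by
    toggling the smallest toggleable edge, the pivot of u: toggling leaves the
    pivot unchanged ([pivot_insert], [pivot_remove]), so it is an involution,
    its pairs are those of A ([matching_toggle]) and its fixed points are the
    F-admissible symbols ([F_admissibleE]).

    The matching is acyclic.  Give an edge activity 2 in u if it is toggleable, 1
    if it is a member of u that is not toggleable, and 0 otherwise.  When a
    gradient path inserts a pivot, removes another edge, and is able to go on by
    an insertion, the activities decrease lexicographically, small edges being
    compared first ([gradient_step_precedes]).

    The algebra is a triangular elimination.  The sums G of the weights of
    gradient paths satisfy the recursion on the first step ([gps_rec]).  It
    implies that summing a chain against G is a chain map from the Taylor
    complex onto F ([flow_boundary]); acyclicity implies that a cycle of F is
    the image of a cycle of the Taylor complex ([critical_cycle_lift]).  That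
    cycle bounds, hence so does its image.

    Minimality: in an F-admissible symbol every edge has an endpoint in no other
    member ([private_endpoint]), because otherwise it would be a bridge.  So a
    facet has a strictly smaller multidegree, and multidegrees do not grow along
    gradient paths. *)

(** * Parents in a rooted tree *)

Section RootedTree.

Context (n : nat) (T : rel 'I_n) (r : 'I_n) (s : seq 'I_n).
Context (tree_T : is_tree T) (listing_s : rank_listing T r s).

Lemma dist_le_walk (p : seq 'I_n) : path T r p -> (size p < n)%N ->
  (dist T r (last r p) <= size p)%N.
Proof.
move=> pp pn; rewrite leqNgt; apply/negP => /(before_find 0%N).
rewrite nth_iota // add0n => /existsP[]; exists (in_tuple p).
by rewrite pp eqxx.
Qed.

Lemma geodesic x : exists p, [/\ path T r p, last r p = x,
  size p = dist T r x & (size p < n)%N].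
Proof.
case: tree_T => _ _ conn _.
have has_walk : has (fun k => [exists p : k.-tuple 'I_n,
    path T r p && (last r p == x)]) (iota 0 n).
  have /connectP[p0 pp0 ->] := conn r x; case/shortenP: pp0 => p pp up _.
  apply/hasP; exists (size p); last first.
    by apply/existsP; exists (in_tuple p); rewrite pp eqxx.
  rewrite mem_iota /= add0n.
  by have := max_card (mem (r :: p)); rewrite (card_uniqP up) card_ord.
have lt := has_walk; rewrite has_find size_iota in lt.
have := nth_find 0%N has_walk; rewrite nth_iota // add0n.
case/existsP => p /andP[pp /eqP lp].
by exists p; rewrite size_tuple.
Qed.

Lemma vgt_dist x y : vgt s x y -> (dist T r x <= dist T r y)%N.
Proof.
case: listing_s => ps; have mem z : z \in s.
  by rewrite (perm_mem ps) mem_enum.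
move=> ss; apply: (sorted_ltn_index (leT := fun x y => (dist T r x <= dist T r y)%N)) => //.
by move=> b a c /=; exact: leq_trans.
Qed.

Lemma vgt_total x y : x != y -> vgt s x y || vgt s y x.
Proof.
case: listing_s => ps _; have mem z : z \in s.
  by rewrite (perm_mem ps) mem_enum.
rewrite /vgt; case: ltngtP => //= e; apply: contraNT => _; apply/eqP.
by rewrite -[x](nth_index x (mem x)) e nth_index.
Qed.

(** A geodesic from the root to x stays at distance less than that of x until it
    ends, so it cannot meet z, which is at least as far from the root. *)
Lemma connect_below x z : T x z -> vgt s x z ->
  connect [rel a b | [&& T a b, a != z & b != z]] r x.
Proof.
case: tree_T => sym irr conn acyc Txz /vgt_dist dxz.
have [p [pp lp sp pn]] := geodesic x.
have xz : x != z by apply: contraTneq Txz => ->; rewrite irr.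
have avoid : z \notin r :: p.
  apply/negP => zp; move: zp pp lp pn sp; case/splitPl => p1 p2 e.
  rewrite cat_path last_cat size_cat e => /andP[pp1 pp2] lp pn sp.
  have := dist_le_walk pp1 (leq_ltn_trans (leq_addr _ _) pn).
  rewrite e => /(leq_trans dxz); rewrite -sp -{2}[size p1]addn0 leq_add2l leqn0.
  by move=> /nilP p20; move: xz; rewrite -lp p20 eqxx.
apply/connectP; exists p => //; move: avoid pp {lp sp pn}.
elim: p (r) => //= a p IH b; rewrite !inE !negb_or.
case/and3P => zb za zp /andP[Tba pp]; rewrite Tba ![_ == z]eq_sym zb za /=.
by apply: IH => //; rewrite inE negb_or za.
Qed.

(** Otherwise the two neighbours would be joined, through the root, off z; a simple
    path joining them closes up at z to a cycle of length at least three. *)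
Lemma parent_unique x y z : T x z -> T y z -> vgt s x z -> vgt s y z -> x = y.
Proof.
move=> Txz Tyz xz yz; have [sym irr conn acyc] := tree_T.
set e := [rel a b | [&& T a b, a != z & b != z]].
have esym : connect_sym e.
  by apply: sym_connect_sym => a b /=; rewrite sym [X in _ && X]andbC.
have : connect e x y.
  by apply: (@connect_trans _ e r); [rewrite esym|]; exact: connect_below.
case/connectP => p0 pp0 ly; apply/eqP; apply: contraT => ne.
case/shortenP: pp0 ly => p pp up _ ly.
have [Tp zp] : path T x p /\ z \notin p.
  elim: p (x) pp {up ly} => //= a p IH b /andP[/and3P[Tba _ az] /IH[pT zp]].
  by rewrite Tba inE negb_or eq_sym az.
have xz' : z != x by apply: contraTneq Txz => ->; rewrite irr.
have /acyc : ucycle T (z :: x :: p).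
  apply/andP; split; last by rewrite cons_uniq inE negb_or xz' zp.
  by rewrite /= sym Txz rcons_path Tp -ly Tyz.
by case: p ly {pp up Tp zp} => //= e'; rewrite e' eqxx in ne.
Qed.

End RootedTree.

(** * The matching as a toggle *)

Lemma facetP (n : nat) (T : rel 'I_n) (v w : {set {set 'I_n}}) :
  reflect (is_symbol T w /\ exists e, [/\ e \in edges T, e \notin w & v = e |: w])
    (facet T v w).
Proof.
apply: (iffP and4P) => [[sv sw wv /eqP cv]|[sw [e [eT ew ->]]]]; last first.
  split=> //; last by rewrite cardsU1 ew.
    by rewrite /is_symbol subUset sub1set eT.
  exact: subsetUr.
split=> //; have /cards1P[e ve] : #|v :\: w| == 1%N.
  by rewrite cardsD (setIidPr wv) cv subSnn.
have /setDP[ev ew] : e \in v :\: w by rewrite ve set11.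
exists e; split=> //; first exact: (subsetP sv).
by rewrite -ve setUC -{1}(setID v w) (setIidPr wv).
Qed.

Section Matching.

Context (n : nat) (T : rel 'I_n) (s : seq 'I_n).
Local Notation symb := {set {set 'I_n}}.
Local Notation edge := {set 'I_n}.
Definition pos (x : 'I_n) : nat := index x s.

Lemma vgtE x y : vgt s x y = (pos x < pos y).
Proof. by []. Qed.

Definition parent (x z : 'I_n) : bool := T x z && vgt s x z.

Context (T_sym : ssrbool.symmetric T) (T_irr : irreflexive T).
Context (vgt_tot : forall x y, x != y -> vgt s x y || vgt s y x).
Context (parent_inj : forall x y z, parent x z -> parent y z -> x = y).

Lemma pos_eqE x y : (x == y) = (pos x == pos y).
Proof.
apply/eqP/eqP => [->//|e]; apply/eqP; apply: contraT => /vgt_tot.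
by rewrite !vgtE e ltnn.
Qed.

Lemma parentT x z : parent x z -> T x z.
Proof. by case/andP. Qed.

Lemma parent_lt x z : parent x z -> (pos x < pos z)%N.
Proof. by case/andP. Qed.

Lemma edgesP (mu : edge) :
  reflect (exists x z, parent x z /\ mu = [set x; z]) (mu \in edges T).
Proof.
rewrite inE; apply: (iffP existsP) => [[x /existsP[y /andP[Txy /eqP ->]]]|].
  have /vgt_tot/orP[h|h] : x != y by apply: contraTneq Txy => ->; rewrite T_irr.
    by exists x, y; rewrite /parent Txy h.
  by exists y, x; rewrite /parent T_sym Txy h setUC.
by move=> [x [z [/parentT Txz ->]]]; exists x; apply/existsP; exists z; rewrite Txz eqxx.
Qed.

Lemma edge_set2 x z : parent x z -> [set x; z] \in edges T.
Proof. by move=> p; apply/edgesP; exists x, z. Qed.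

Lemma parent_set2_inj x z x' z' : parent x z -> parent x' z' ->
  [set x; z] = [set x'; z'] -> x = x' /\ z = z'.
Proof.
move=> /parent_lt lt /parent_lt lt' /setP e.
have := (e x, e z, e x', e z'); rewrite !inE !eqxx !orbT /= !pos_eqE.
move=> h; split; apply/eqP; rewrite pos_eqE; move: h => [[[]]]; lia.
Qed.

Lemma set2_edge x y : [set x; y] \in edges T -> T x y.
Proof.
case/edgesP => a [b [pab /setP e]]; have := (e x, e y, e a, e b).
have Tab := parentT pab; have lt := parent_lt pab.
rewrite !inE !eqxx !orbT /= => -[[[h1 h2] h3] h4].
have [[-> ->]|[-> ->]] : (x = a /\ y = b) \/ (x = b /\ y = a); last 2 first.
- by [].
- by rewrite T_sym.
by have [xa|xa] := boolP (x == a); [left|right]; split; apply/eqP;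
  move: h1 h2 h3 h4 xa; rewrite !pos_eqE; lia.
Qed.

(** The lexicographic position of an edge, its earlier endpoint being compared
    first: a larger code means a smaller monomial. *)
Definition code (mu : edge) : nat :=
  if [pick p | parent p.1 p.2 && (mu == [set p.1; p.2])] is Some p
  then pos p.1 * (size s).+1 + pos p.2 else 0.

Lemma code_set2 x z : parent x z ->
  code [set x; z] = (pos x * (size s).+1 + pos z)%N.
Proof.
move=> pxz; rewrite /code; case: pickP => [[a b] /= /andP[pab /eqP e]|/(_ (x, z))].
  by have [-> ->] := parent_set2_inj pxz pab e.
by rewrite /= pxz eqxx.
Qed.

Lemma code_lt x z x' z' : parent x z -> parent x' z' ->
  (code [set x; z] < code [set x'; z'])%N =
  (pos x < pos x')%N || (x == x') && (pos z < pos z')%N.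
Proof.
move=> p p'; rewrite !code_set2 // pos_eqE.
have : (pos z <= size s)%N by exact: index_size.
have : (pos z' <= size s)%N by exact: index_size.
move: (pos x) (pos z) (pos x') (pos z') (size s) => a b a' b' N h h'.
by case: (ltngtP a a') => [lt|lt|->]; last lia; nia.
Qed.

Lemma code_child x z w : parent x z -> parent z w ->
  (code [set x; z] < code [set z; w])%N.
Proof. by move=> p p'; rewrite code_lt // (parent_lt p). Qed.

Lemma code_inj mu nu : mu \in edges T -> nu \in edges T -> code mu = code nu ->
  mu = nu.
Proof.
move=> /edgesP[x [z [p ->]]] /edgesP[x' [z' [p' ->]]] e.
have := code_lt p p'; have := code_lt p' p; rewrite e ltnn => h h'.
have /eqP -> : x == x' by rewrite pos_eqE; lia.
by have /eqP -> : z == z' by move: h h'; rewrite !pos_eqE; lia.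
Qed.

(** The first vertex at which the edges differ decides; it is an earlier endpoint
    unless these coincide. *)
Lemma egtE x z x' z' : parent x z -> parent x' z' ->
  egt s [set x; z] [set x'; z'] =
  (pos x < pos x')%N || (x == x') && (pos z < pos z')%N.
Proof.
move=> /parent_lt p /parent_lt p'; rewrite /egt /lexgt.
apply/existsP/idP => [[i /andP[lt /forallP h]]|].
  move: lt; rewrite !mnmE !inE.
  have hh j : (pos j < pos i)%N -> (j \in [set x; z]) = (j \in [set x'; z']).
    by move=> ji; have := h j; rewrite vgtE ji /= !mnmE; do 2!case: (_ \in _).
  have := (hh x, hh z, hh x', hh z').
  rewrite !inE !pos_eqE !eqxx ?orbT /=; move=> [[[h1 h2] h3] h4].
  have [ex|nx] := boolP (pos i == pos x); lia.
case/orP => [lt|/andP[/eqP ex lt]].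
  exists x; rewrite !mnmE !inE eqxx !pos_eqE /=; apply/andP; split; first lia.
  apply/forallP => j; apply/implyP; rewrite vgtE !mnmE !inE !pos_eqE => lj; lia.
exists z; rewrite !mnmE !inE eqxx orbT -ex !pos_eqE /=; apply/andP; split; first lia.
apply/forallP => j; apply/implyP; rewrite vgtE !mnmE !inE !pos_eqE => lj; lia.
Qed.

Lemma egt_code mu nu : mu \in edges T -> nu \in edges T ->
  egt s mu nu = (code mu < code nu)%N.
Proof.
by move=> /edgesP[x [z [p ->]]] /edgesP[x' [z' [p' ->]]]; rewrite egtE // code_lt.
Qed.

Implicit Types u : symb.
Definition leaf (u : symb) (w : 'I_n) : bool :=
  [forall v, parent w v ==> ([set w; v] \notin u)].

(** All that is asked of u for {x, z} to be the bridge of a gap y - x - z - w, except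
    that {x, z} be absent.  An edge at y smaller than {z, w} leads to a child of y,
    and can occur only if y comes after z. *)
Definition toggleable (u : symb) (x z : 'I_n) : bool :=
  [&& parent x z,
      [exists w, [&& parent z w, [set z; w] \in u & leaf u w]]
    & [exists y, [&& y != z, [set x; y] \in u & vgt s y z || leaf u y]]].

Lemma toggleableP (u : symb) x z :
  reflect [/\ parent x z,
    exists w, [/\ parent z w, [set z; w] \in u & leaf u w]
  & exists y, [/\ y != z, [set x; y] \in u & vgt s y z || leaf u y]]
  (toggleable u x z).
Proof.
apply: (iffP and3P) => -[p h1 h2]; split=> //.
- by case/existsP: h1 => w /and3P; exists w.
- by case/existsP: h2 => w /and3P; exists w.
- by case: h1 => w /and3P h; apply/existsP; exists w.
- by case: h2 => w /and3P h; apply/existsP; exists w.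
Qed.

Lemma leafP (u : symb) w : reflect (forall v, parent w v -> [set w; v] \notin u) (leaf u w).
Proof. by apply: (iffP forallP) => h v; move: (h v) => /implyP. Qed.

Lemma symbol_edge (u : symb) mu : is_symbol T u -> mu \in u -> mu \in edges T.
Proof. by move=> /subsetP; apply. Qed.

Lemma later_sibling (u : symb) x y z : is_symbol T u -> parent x z -> y != z ->
  [set x; y] \in u -> ~~ vgt s y z -> parent x y /\ (pos z < pos y)%N.
Proof.
move=> us /parent_lt p; rewrite pos_eqE vgtE => ne xy nlt.
have Txy := set2_edge (symbol_edge us xy).
have lt : (pos z < pos y)%N by lia.
by split=> //; rewrite /parent Txy vgtE; lia.
Qed.

(** The hypotheses record how the condition depends on the symbol: monotonically on
    the edges {z, w} and {x, y}, and antitonically on the edges from w, or from a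
    later sibling y of z, to a child.  The latter are all smaller than {x, z}. *)
Lemma toggleable_transfer (u u' : symb) x z : is_symbol T u -> toggleable u x z ->
  (forall w, parent z w -> [set z; w] \in u -> [set z; w] \in u') ->
  (forall w v, parent z w -> parent w v -> [set w; v] \in u' -> [set w; v] \in u) ->
  (forall y, y != z -> [set x; y] \in u -> [set x; y] \in u') ->
  (forall y v, parent x y -> (pos z < pos y)%N -> parent y v ->
     [set y; v] \in u' -> [set y; v] \in u) ->
  toggleable u' x z.
Proof.
move=> us /toggleableP[p [w [pw zw lw]] [y [ne xy ly]]] h1 h2 h3 h4.
apply/toggleableP; split=> //.
  exists w; split=> //; first exact: h1.
  apply/leafP => v pv; apply: contra (leafP _ _ lw v pv); exact: h2.
exists y; split=> //; first exact: h3.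
have [//|nlt] := boolP (vgt s y z); rewrite (negPf nlt) /= in ly *.
have [pxy lt] := later_sibling us p ne xy nlt.
by apply/leafP => v pv; apply: contra (leafP _ _ ly v pv); exact: h4.
Qed.

Lemma toggleable_ext (u u' : symb) x z : is_symbol T u ->
  (forall nu, nu \in edges T -> nu != [set x; z] -> (nu \in u) = (nu \in u')) ->
  toggleable u x z -> toggleable u' x z.
Proof.
move=> us e t; have [p _ _] := toggleableP _ _ _ t.
have pxz := parent_lt p.
apply: (toggleable_transfer us t) => [w pw|w v pw pv|y ne xy|y v py lt pv].
- rewrite e ?edge_set2 //; apply/eqP => /(parent_set2_inj pw p)[ezx _].
  by rewrite ezx ltnn in pxz.
- rewrite e ?edge_set2 //; apply/eqP => /(parent_set2_inj pv p)[ezx _].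
  by move: (parent_lt pw); rewrite ezx; lia.
- rewrite -e //; first exact: symbol_edge xy.
  apply: contraNneq ne => /setP/(_ y); rewrite !inE eqxx orbT => /esym.
  case/orP => // /eqP yx; have := set2_edge (symbol_edge us xy).
  by rewrite yx T_irr.
rewrite e ?edge_set2 //; apply/eqP => /(parent_set2_inj pv p)[eyx _].
by move: lt; rewrite eyx; lia.
Qed.

(** A removal can create toggleability only through the antitone part of the
    condition, which concerns edges smaller than {x, z}. *)
Lemma toggleable_remove (u : symb) f x z : is_symbol T u -> f \in edges T ->
  (code f < code [set x; z])%N -> toggleable (u :\ f) x z -> toggleable u x z.
Proof.
move=> us fT lt t; have [p _ _] := toggleableP _ _ _ t.
have pxz := parent_lt p.
have us' : is_symbol T (u :\ f) by apply: subset_trans us; exact: subsetDl.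
apply: (toggleable_transfer us' t) => [w pw|w v pw pv wv|y ne|y v py lt' pv yv].
- by case/setD1P.
- apply/setD1P; split=> //; apply: contraTneq lt => <-; rewrite code_lt //.
  by have := parent_lt pw; have := parent_lt pv; rewrite pos_eqE; lia.
- by case/setD1P.
apply/setD1P; split=> //; apply: contraTneq lt => <-; rewrite code_lt //.
by have := parent_lt py; rewrite pos_eqE; lia.
Qed.

(** The edge {a, b} could help only in the role of {x, y}.  But an edge at x serving
    instead is provided by the toggleability of {a, b}: a leaf child of b if x = b,
    the edge that plays {x, y} for {a, b} if x = a. *)
Lemma toggleable_insert (u : symb) a b x z : is_symbol T u -> toggleable u a b ->
  (code [set a; b] < code [set x; z])%N ->
  toggleable ([set a; b] |: u) x z -> toggleable u x z.
Proof.
move=> us t lt /toggleableP[p [w [pw zw lw]] [y [ne xy ly]]].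
have [pab [z' [pz' bz' lz']] [y2 [ne2 ay2 ly2]]] := toggleableP _ _ _ t.
have pxz := parent_lt p; have pab' := parent_lt pab.
move: (lt); rewrite code_lt // => lt'.
have leafU v : leaf ([set a; b] |: u) v -> leaf u v.
  move=> /leafP h; apply/leafP => v' pv; apply: contra (h v' pv).
  by rewrite in_setU1 orbC => ->.
have zw' : [set z; w] \in u.
  move: zw; rewrite in_setU1 => /orP[/eqP e|//]; move: lt.
  by rewrite -e ltnNge ltnW // code_child.
have nlz : leaf u z = false.
  by apply/negP => /leafP/(_ _ pw); rewrite zw'.
apply/toggleableP; split=> //; first by exists w; split=> //; exact: leafU.
move: xy; rewrite in_setU1 => /orP[/eqP e|xy]; last first.
  exists y; split=> //; case/orP: ly => [->//|/leafU ->]; exact: orbT.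
have : x \in [set a; b] by rewrite -e !inE eqxx.
rewrite !inE => /orP[/eqP xa|/eqP xb].
  have {lt'} bz : (pos b < pos z)%N by move: lt'; rewrite xa ltnn eqxx.
  exists y2; rewrite xa; split=> //.
    by apply: contraTneq ly2 => ->; rewrite nlz orbF vgtE -leqNgt ltnW.
  case/orP: ly2 => [h|->]; last exact: orbT.
  by rewrite vgtE (ltn_trans h bz).
exists z'; rewrite xb; split=> //; last by rewrite lz' orbT.
by apply: contraTneq lz' => ->; rewrite nlz.
Qed.

Definition edge_toggleable (u : symb) (mu : edge) : bool :=
  [exists x, [exists z, (mu == [set x; z]) && toggleable u x z]].

Lemma edge_toggleableP u mu :
  reflect (exists x z, mu = [set x; z] /\ toggleable u x z) (edge_toggleable u mu).
Proof.
apply: (iffP existsP) => [[x /existsP[z /andP[/eqP -> t]]]|[x [z [-> t]]]].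
  by exists x, z.
by exists x; apply/existsP; exists z; rewrite eqxx.
Qed.

Lemma edge_toggleable_edge u mu : edge_toggleable u mu -> mu \in edges T.
Proof.
case/edge_toggleableP => x [z [-> /toggleableP[p _ _]]]; exact: edge_set2.
Qed.

Lemma edge_toggleableE u x z : parent x z ->
  edge_toggleable u [set x; z] = toggleable u x z.
Proof.
move=> p; apply/edge_toggleableP/idP => [[a [b [e t]]]|t]; last by exists x, z.
have [p' _ _] := toggleableP _ _ _ t.
by have [-> ->] := parent_set2_inj p p' e.
Qed.

Definition pivot (u : symb) : option edge :=
  [pick mu | edge_toggleable u mu &&
     [forall nu, edge_toggleable u nu ==> (code nu <= code mu)%N]].

Lemma pivotP u mu : reflect (edge_toggleable u mu /\
    forall nu, edge_toggleable u nu -> (code nu <= code mu)%N)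
  (pivot u == Some mu).
Proof.
rewrite /pivot; case: pickP => [nu /andP[t /forallP h]|no].
  apply: (iffP eqP) => [[<-]|[t' h']].
    by split=> // la /(implyP (h la)).
  congr Some; apply: (code_inj (edge_toggleable_edge t) (edge_toggleable_edge t')).
  by apply/eqP; rewrite eqn_leq h' //= (implyP (h mu)).
apply: (iffP eqP) => // -[t h]; have := no mu; rewrite t /= => /negbT/negP[].
by apply/forallP => nu; apply/implyP; exact: h.
Qed.

Lemma pivot_none u mu : pivot u = None -> edge_toggleable u mu = false.
Proof.
rewrite /pivot; case: pickP => // no _; case t: (edge_toggleable u mu) => //.
case: (arg_maxnP code t) => nu t' h; rewrite -(no nu) t' /=; apply/esym/forallP.
by move=> la; apply/implyP; exact: h.
Qed.

Lemma toggle_self (u u' : symb) mu : is_symbol T u ->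
  (forall nu, nu != mu -> (nu \in u) = (nu \in u')) ->
  edge_toggleable u mu -> edge_toggleable u' mu.
Proof.
move=> us e /edge_toggleableP[x [z [emu t]]]; apply/edge_toggleableP; exists x, z.
by split=> //; apply: (toggleable_ext us) t => nu _; rewrite -emu; exact: e.
Qed.

Lemma edge_toggleable_remove (u : symb) f mu : is_symbol T u -> f \in edges T ->
  (code f < code mu)%N -> edge_toggleable (u :\ f) mu -> edge_toggleable u mu.
Proof.
move=> us fT lt /edge_toggleableP[x [z [e t]]]; apply/edge_toggleableP; exists x, z.
by split=> //; apply: toggleable_remove t; rewrite // -e.
Qed.

Lemma edge_toggleable_insert (u : symb) e mu : is_symbol T u ->
  edge_toggleable u e -> (code e < code mu)%N ->
  edge_toggleable (e |: u) mu -> edge_toggleable u mu.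
Proof.
move=> us /edge_toggleableP[a [b [-> t]]] lt /edge_toggleableP[x [z [e' t']]].
apply/edge_toggleableP; exists x, z; split=> //; apply: (toggleable_insert us t) t'.
by rewrite -e'.
Qed.

Lemma symbolU1 mu (u : symb) : mu \in edges T -> is_symbol T u -> is_symbol T (mu |: u).
Proof. by move=> h us; rewrite /is_symbol subUset sub1set h. Qed.

Lemma symbolD1 mu (u : symb) : is_symbol T u -> is_symbol T (u :\ mu).
Proof. by apply: subset_trans; exact: subsetDl. Qed.

(** Neither the toggleability of the pivot nor that of the smaller edges is affected
    when the pivot is inserted. *)
Lemma pivot_insert (u : symb) mu : is_symbol T u -> pivot u = Some mu ->
  pivot (mu |: u) = Some mu.
Proof.
move=> us /eqP/pivotP[t h]; apply/eqP/pivotP; split.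
  by apply: (toggle_self us) t => nu ne; rewrite in_setU1 (negPf ne).
move=> nu t'; rewrite leqNgt; apply/negP => lt.
have := h nu (edge_toggleable_insert us t lt t').
by rewrite leqNgt lt.
Qed.

Lemma pivot_remove (u : symb) mu : is_symbol T u -> pivot u = Some mu ->
  pivot (u :\ mu) = Some mu.
Proof.
move=> us /eqP/pivotP[t h]; apply/eqP/pivotP; split.
  by apply: (toggle_self us) t => nu ne; rewrite in_setD1 ne.
move=> nu t'; rewrite leqNgt; apply/negP => lt.
have := h nu (edge_toggleable_remove us (edge_toggleable_edge t) lt t').
by rewrite leqNgt lt.
Qed.

Lemma child_of x z w : parent x z -> T z w -> w != x -> parent z w.
Proof.
move=> p Tzw ne; rewrite /parent Tzw /=.
have /vgt_tot/orP[//|wz] : z != w by apply: contraTneq Tzw => ->; rewrite T_irr.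
have pwz : parent w z by rewrite /parent T_sym Tzw.
by move: ne; rewrite (parent_inj pwz p) eqxx.
Qed.

(** If y were equal to w, then x and z would be two parents of w. *)
Lemma tree_path_uniq x y z w : parent x z -> parent z w -> y != z -> T x y ->
  uniq [:: x; y; z; w].
Proof.
move=> p pw ne Txy; have := parent_lt p; have := parent_lt pw => zw xz.
have yw : y != w.
  apply: contraTneq Txy => ->; apply/negP => Txw.
  have pxw : parent x w by rewrite /parent Txw vgtE (ltn_trans xz zw).
  by move: xz; rewrite (parent_inj pxw pw) ltnn.
have xy : x != y by apply: contraTneq Txy => ->; rewrite T_irr.
rewrite /= !inE !negb_or xy ne yw !pos_eqE !neq_ltn xz zw.
by rewrite (ltn_trans xz zw).
Qed.

Definition bridge_at (u : symb) (x z : 'I_n) : Prop :=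
  [/\ parent x z, [set x; z] \in u, exists2 w, parent z w & [set z; w] \in u
    & exists2 y, y != z & [set x; y] \in u].

(** A bridge goes from a parent x to a child z because exchanging the roles of the
    two sides of the path orients it; every other neighbour of z is then a child. *)
Lemma bridgesP (u : symb) mu : is_symbol T u ->
  reflect (exists x z, mu = [set x; z] /\ bridge_at u x z) (mu \in bridges u).
Proof.
move=> us; rewrite inE; apply: (iffP existsP); last first.
  move=> [x [z [-> [p xz [w pw zw] [y ne xy]]]]]; exists x; apply/existsP; exists y.
  apply/existsP; exists z; apply/existsP; exists w; rewrite xy zw xz eqxx !andbT.
  exact: tree_path_uniq (set2_edge (symbol_edge us xy)).
move=> [x /existsP[y /existsP[z /existsP[w /and5P[un xy zw xz /eqP ->]]]]].
have Txy := set2_edge (symbol_edge us xy).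
have Tzw := set2_edge (symbol_edge us zw).
have Txz := set2_edge (symbol_edge us xz).
move: un; rewrite /= !inE !negb_or => /and4P[/and3P[nxy nxz nxw] /andP[nyz nyw] nzw _].
case/orP: (vgt_tot nxz) => lt.
  have p : parent x z by rewrite /parent Txz.
  exists x, z; split=> //; split=> //; last by exists y.
  by exists w => //; apply: child_of p Tzw _; rewrite eq_sym.
have p : parent z x by rewrite /parent T_sym Txz.
exists z, x; split; first exact: setUC.
split; rewrite // 1?setUC //; last by exists w => //; rewrite eq_sym.
by exists y => //; apply: child_of p Txy _.
Qed.

Lemma toggleable_bridge (u : symb) mu : is_symbol T u -> mu \in u ->
  edge_toggleable u mu -> mu \in bridges u.
Proof.
move=> us muu /edge_toggleableP[x [z [emu /toggleableP[p [w [pw zw _]] [y [ne xy _]]]]]].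
by apply/bridgesP => //; exists x, z; split=> //; split; rewrite -?emu //;
  [exists w|exists y].
Qed.

(** The smallest bridge is toggleable.  If w, or a later sibling y of z, had an edge
    to a child, then {z, w}, or {x, y}, would be a smaller bridge. *)
Lemma bridge_toggleable (u : symb) mu : is_symbol T u -> mu \in bridges u ->
  exists2 nu, edge_toggleable u nu & (code mu <= code nu)%N.
Proof.
move=> us mub; case: (arg_maxnP code mub) => nu nub hmax.
exists nu; last exact: hmax.
case/bridgesP: (nub) => // x [z [enu [p xz [w pw zw] [y ne xy]]]].
have no_child a b : bridge_at u a b -> ~~ (code nu < code [set a; b])%N.
  by move=> ab; rewrite -leqNgt; apply: hmax; apply/bridgesP => //; exists a, b.
apply/edge_toggleableP; exists x, z; split=> //; apply/toggleableP; split=> //.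
  exists w; split=> //; apply/leafP => v pv; apply/negP => wv.
  have /no_child : bridge_at u z w.
    split=> //; [by exists v|exists x; last by rewrite setUC].
    by rewrite pos_eqE neq_ltn (ltn_trans (parent_lt p) (parent_lt pw)).
  by rewrite enu code_child.
exists y; split=> //; have [//|nlt /=] := boolP (vgt s y z).
have [py zy] := later_sibling us p ne xy nlt.
apply/leafP => v pv; apply/negP => yv.
have /no_child : bridge_at u x y.
  by split=> //; [exists v|exists z => //; rewrite eq_sym].
by rewrite enu code_lt // zy eqxx orbT.
Qed.

(** In a gap too the bridge goes from the parent x to the child z: if z were the
    parent of x, then y would be a child of x, and {x, y} would be smaller than
    {z, w}. *)
Lemma is_gapP (u : symb) x y z w : is_symbol T u ->
  reflect ([/\ parent x z, [set x; z] \notin u, parent z w, [set z; w] \in u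
     & leaf u w] /\ [/\ y != z, [set x; y] \in u & vgt s y z || leaf u y])
    (is_gap T s u x y z w).
Proof.
move=> us; rewrite /is_gap; apply: (iffP idP); last first.
  move=> [[p xz pw zw lw] [ne xy ly]].
  have Txy := set2_edge (symbol_edge us xy).
  rewrite (tree_path_uniq p pw ne Txy) xy zw (parentT p) xz /=.
  have xz_lt := parent_lt p; have zw_lt := parent_lt pw.
  have -> : egt s [set x; y] [set z; w].
    have [pxy|npxy] := boolP (parent x y).
      by rewrite egt_code ?edge_set2 // code_lt // xz_lt.
    have pyx : parent y x.
      have nxy : x != y by apply: contraTneq Txy => ->; rewrite T_irr.
      rewrite /parent T_sym Txy /=; case/orP: (vgt_tot nxy) => // h.
      by rewrite /parent Txy h in npxy.
    by rewrite setUC egt_code ?edge_set2 // code_lt // (ltn_trans (parent_lt pyx)).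
  rewrite /=; apply/andP; split; apply/forallP => mu; apply/implyP => muu; apply/implyP.
    case/edgesP: (symbol_edge us muu) => a [b [pab emu]].
    rewrite emu !inE => /orP[/eqP wa|/eqP wb].
      by have := leafP _ _ lw b; rewrite wa -emu muu => /(_ pab).
    by rewrite -wb in pab *; rewrite (parent_inj pab pw).
  case/edgesP: (symbol_edge us muu) => a [b [pab emu]].
  rewrite egt_code ?edge_set2 ?(symbol_edge us) // emu code_lt // => lt.
  have za : (pos z <= pos a)%N by case/orP: lt => [/ltnW//|/andP[/eqP-> _]].
  apply/negP; rewrite !inE => /orP[/eqP ya|/eqP yb].
    case/orP: ly => [yz|/leafP/(_ b)].
      by move: za; rewrite leqNgt -ya (_ : (_ < _)%N).
    by rewrite ya -emu muu => /(_ pab).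
  have [yz|nyz] := boolP (vgt s y z).
    by move: za; rewrite leqNgt (ltn_trans (parent_lt pab)) // -yb.
  have [pxy zy] := later_sibling us p ne xy nyz.
  by move: za; rewrite leqNgt -yb in pab *; rewrite (parent_inj pab pxy) xz_lt.
case/and5P => un xy zw gt /and4P[Txz xz /forallP hw /forallP hy].
have Txy := set2_edge (symbol_edge us xy).
have Tzw := set2_edge (symbol_edge us zw).
move: un; rewrite /= !inE !negb_or => /and4P[/and3P[nxy nxz nxw] /andP[nyz nyw] nzw _].
have p : parent x z.
  rewrite /parent Txz /=; case/orP: (vgt_tot nxz) => // zx.
  have pzx : parent z x by rewrite /parent T_sym Txz.
  have pxy : parent x y by apply: child_of pzx Txy _.
  move: gt; case/orP: (vgt_tot nzw) => lt.
    have pzw : parent z w by rewrite /parent Tzw.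
    rewrite egt_code ?edge_set2 // ltnNge ltnW // code_lt //.
    by rewrite (parent_lt pzx).
  have pwz : parent w z by rewrite /parent T_sym Tzw.
  rewrite [X in egt _ _ X]setUC egt_code ?edge_set2 // ltnNge ltnW // code_lt //.
  by rewrite (ltn_trans (parent_lt pwz) (parent_lt pzx)).
have pw : parent z w by apply: child_of p Tzw _; rewrite eq_sym.
split; split=> //.
  apply/leafP => v pv; apply/negP => wv; have := hw [set w; v].
  rewrite wv !inE eqxx /= => /eqP /(parent_set2_inj pv pw)[wz _].
  by rewrite wz eqxx in nzw.
have [//|nlt /=] := boolP (vgt s y z); apply/leafP => v pv; apply/negP => yv.
have [pxy zy] := later_sibling us p nyz xy nlt.
have := hy [set y; v]; rewrite yv !inE eqxx /= implybF.
by rewrite egt_code ?edge_set2 // code_lt // zy.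
Qed.

Lemma gap_bridgesE (u : symb) mu : is_symbol T u ->
  (mu \in gap_bridges T s u) = (mu \notin u) && edge_toggleable u mu.
Proof.
move=> us; rewrite inE; apply/existsP/andP.
  move=> [x /existsP[y /existsP[z /existsP[w /andP[/(is_gapP _ _ _ _ us) g /eqP ->]]]]].
  case: g => -[p xz pw zw lw] [ne xy ly]; rewrite xz edge_toggleableE //; split=> //.
  by apply/toggleableP; split=> //; [exists w|exists y].
move=> [nmu /edge_toggleableP[x [z [emu /toggleableP[p [w [pw zw lw]] [y [ne xy ly]]]]]]].
exists x; apply/existsP; exists y; apply/existsP; exists z; apply/existsP; exists w.
rewrite emu eqxx andbT; apply/is_gapP => //; split=> //.
by rewrite -emu.
Qed.

Lemma has_gap_toggleable (u : symb) : is_symbol T u -> has_gap T s u ->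
  exists mu, edge_toggleable u mu.
Proof.
move=> us /existsP[x /existsP[y /existsP[z /existsP[w g]]]]; exists [set x; z].
have : [set x; z] \in gap_bridges T s u.
  rewrite inE; apply/existsP; exists x; apply/existsP; exists y.
  by apply/existsP; exists z; apply/existsP; exists w; rewrite g /=.
by rewrite gap_bridgesE // => /andP[].
Qed.

Lemma toggleable_gap (u : symb) mu : is_symbol T u -> mu \notin u ->
  edge_toggleable u mu -> has_gap T s u.
Proof.
move=> us nmu t; have : mu \in gap_bridges T s u by rewrite gap_bridgesE // nmu.
rewrite inE => /existsP[x /existsP[y /existsP[z /existsP[w /andP[g _]]]]].
apply/existsP; exists x; apply/existsP; exists y.
by apply/existsP; exists z; apply/existsP; exists w.
Qed.

Lemma type1P (u : symb) : is_symbol T u ->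
  reflect (exists2 mu, mu \in gap_bridges T s u
             & forall la, la \in bridges u -> (code la <= code mu)%N)
    (type1 T s u).
Proof.
move=> us; have be la : la \in bridges u -> la \in edges T.
  by move=> /(bridgesP _ us)[x [z [-> [/edge_set2]]]].
apply: (iffP existsP) => [[x]|[mu mug h]].
  move=> /existsP[y /existsP[z /existsP[w /andP[g /forallP h]]]].
  exists [set x; z] => [|la lab].
    rewrite inE; apply/existsP; exists x; apply/existsP; exists y.
    by apply/existsP; exists z; apply/existsP; exists w; rewrite g /=.
  have [[p _ _ _ _] _] := is_gapP _ _ _ _ us g.
  have := h la; rewrite lab /= egt_code ?(edge_set2 p) ?be //.
  by rewrite -leqNgt.
move: (mug); rewrite inE => /existsP[x /existsP[y /existsP[z /existsP[w]]]].
case/andP => g /eqP emu; exists x; apply/existsP; exists y.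
apply/existsP; exists z; apply/existsP; exists w; rewrite g /=.
have [[p _ _ _ _] _] := is_gapP _ _ _ _ us g.
apply/forallP => la; apply/implyP => lab.
by rewrite egt_code ?(edge_set2 p) ?be // -leqNgt -emu h.
Qed.

(** If the pivot belonged to u', it would be a bridge of u' at least as small as
    each bridge of a gap, and every gap would be followed by it. *)
Lemma matchingE (u u' : symb) : matching T s u u' =
  is_symbol T u' &&
  (if pivot u' is Some mu then (mu \notin u') && (u == mu |: u') else false).
Proof.
apply/and3P/andP.
  move=> [/and4P[_ us _ _] /(type1P us)[mu mug h] /existsP[mu0]].
  case/andP => mu0g /andP[/forallP hmin /eqP ->]; split=> //.
  move: (mu0g); rewrite gap_bridgesE // => /andP[nmu0 t0].
  have mu0T := edge_toggleable_edge t0.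
  have hm nu : nu \in gap_bridges T s u' -> (code nu <= code mu0)%N.
    move=> nug; have := hmin nu; rewrite nug /= /ege => /orP[/eqP ->//|].
    rewrite egt_code //; first exact: ltnW.
    by move: nug; rewrite gap_bridgesE // => /andP[_ /edge_toggleable_edge].
  suff /eqP -> : pivot u' == Some mu0 by rewrite nmu0 eqxx.
  apply/pivotP; split=> // nu t; have [nuu|nnu] := boolP (nu \in u').
    by apply: leq_trans (h _ (toggleable_bridge us nuu t)) (hm _ mug).
  by apply: hm; rewrite gap_bridgesE // nnu.
move=> [us]; case e: (pivot u') => [mu|//] /andP[nmu /eqP ->].
have /pivotP[t h] : pivot u' == Some mu by rewrite e.
have muT := edge_toggleable_edge t.
have mug : mu \in gap_bridges T s u' by rewrite gap_bridgesE // nmu.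
split.
- by apply/facetP; split=> //; exists mu.
- apply/type1P => //; exists mu => // la /(bridge_toggleable us)[nu tn] /leq_trans; apply.
  exact: h.
apply/existsP; exists mu; rewrite mug eqxx andbT /=.
apply/forallP => nu; apply/implyP; rewrite gap_bridgesE // => /andP[_ tn].
rewrite /ege; case: eqP => //= ne; rewrite egt_code ?(edge_toggleable_edge tn) //.
rewrite ltn_neqAle h // andbT; apply/eqP => /code_inj e'; apply: ne; apply: e' => //.
exact: edge_toggleable_edge tn.
Qed.

Definition toggle (u : symb) : symb :=
  if is_symbol T u then
    if pivot u is Some mu then if mu \in u then u :\ mu else mu |: u else u
  else u.

Lemma toggle_symbol u : is_symbol T (toggle u) = is_symbol T u.
Proof.
rewrite /toggle; case: ifP => us; rewrite ?us //.
case e: (pivot u) => [mu|]; rewrite ?us //.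
have /pivotP[/edge_toggleable_edge muT _] : pivot u == Some mu by rewrite e.
by case: ifP => _; [exact: symbolD1|exact: symbolU1].
Qed.

Lemma toggleK : involutive toggle.
Proof.
move=> u; rewrite {1}/toggle toggle_symbol; case: ifP => us; last first.
  by rewrite /toggle us.
rewrite /toggle us; case e: (pivot u) => [mu|]; last by rewrite ?e.
case: ifP => muu; rewrite ?(pivot_remove us e) ?(pivot_insert us e).
  by rewrite in_setD1 eqxx /= setD1K.
by rewrite setU11 setU1K // muu.
Qed.

Lemma toggle_lower u : (#|u| < #|toggle u|)%N ->
  is_symbol T u /\ exists mu, [/\ pivot u = Some mu, mu \notin u & toggle u = mu |: u].
Proof.
rewrite /toggle; case: ifP => us; last by rewrite ltnn.
case e: (pivot u) => [mu|]; last by rewrite ltnn.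
case: ifP => muu lt; last by split=> //; exists mu; rewrite muu.
by move: lt; rewrite (cardsD1 mu u) muu ltnNge leq_addl.
Qed.

Lemma toggle_card u : #|toggle u| = #|u| -> toggle u = u.
Proof.
rewrite /toggle; case: ifP => // us; case: (pivot u) => // mu.
case: ifP => muu; last by rewrite cardsU1 muu add1n => /esym/n_Sn.
by rewrite [in RHS](cardsD1 mu u) muu add1n => /n_Sn.
Qed.

Lemma matching_toggle (u u' : symb) :
  matching T s u u' = (toggle u' == u) && (#|u'| < #|u|)%N.
Proof.
rewrite matchingE; apply/andP/andP.
  case=> us; case e: (pivot u') => [mu|//] /andP[nmu /eqP ->].
  by rewrite /toggle us e (negPf nmu) eqxx cardsU1 nmu add1n.
case=> /eqP <- /toggle_lower[us [mu [e nmu ->]]].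
by rewrite us e nmu eqxx.
Qed.

(** The endpoints of the pivot {x, z} are covered by {x, y} and {z, w}. *)
Lemma toggle_cover u : cover (toggle u) = cover u.
Proof.
have ins v mu : pivot v = Some mu -> cover (mu |: v) = cover v.
  move=> e; have /pivotP[t _] : pivot v == Some mu by rewrite e.
  rewrite /cover bigcup_setU big_set1; apply/setUidPr.
  case/edge_toggleableP: t => x [z [-> /toggleableP[_ [w [_ zw _]] [y [_ xy _]]]]].
  apply/subsetP => i; rewrite !inE => /orP[/eqP ->|/eqP ->]; apply/bigcupP.
    by exists [set x; y]; rewrite ?inE ?eqxx.
  by exists [set z; w]; rewrite ?inE ?eqxx.
rewrite /toggle; case: ifP => // us; case e: (pivot u) => [mu|//].
case: ifP => muu; last exact: ins.
by rewrite -[u in RHS](setD1K muu) (ins _ _ (pivot_remove us e)).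
Qed.

(** The potential that decreases along gradient paths, in the lexicographic order
    that compares the smallest edges first. *)
Definition activity (u : symb) (h : edge) : nat :=
  if edge_toggleable u h then 2 else (h \in u).

Definition precedes (u v : symb) : bool :=
  [exists h in edges T, (activity v h < activity u h)%N &&
     [forall g in edges T, (code h < code g)%N ==> (activity v g == activity u g)]].

Lemma precedesP u (v : symb) :
  reflect (exists h, [/\ h \in edges T, (activity v h < activity u h)%N &
    forall g, g \in edges T -> (code h < code g)%N -> activity v g = activity u g])
  (precedes u v).
Proof.
apply: (iffP existsP) => [[h /and3P[hT lt /forallP e]]|[h [hT lt e]]]; exists h.
  by split=> // g gT hg; apply/eqP; move: (e g); rewrite gT hg.
rewrite hT lt; apply/forallP => g; apply/implyP => gT; apply/implyP => hg.
by rewrite e.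
Qed.

Lemma precedes_irr : irreflexive precedes.
Proof. by move=> u; apply/precedesP => -[h []]; rewrite ltnn. Qed.

Lemma precedes_trans : transitive precedes.
Proof.
move=> v u w /precedesP[h [hT lt e]] /precedesP[h' [hT' lt' e']].
apply/precedesP; case: (ltngtP (code h) (code h')) => c.
- exists h'; split=> //; first by rewrite -(e h').
  by move=> g gT cg; rewrite e' // e // (ltn_trans c).
- exists h; split=> //; first by rewrite e'.
  by move=> g gT cg; rewrite e' ?e // (ltn_trans c).
have hh := code_inj hT hT' c; exists h; split=> //.
  by apply: ltn_trans lt; rewrite hh.
by move=> g gT cg; rewrite e' ?e // -c.
Qed.

Definition flow_rank (u : symb) : nat := #|[pred v | precedes u v]|.

Lemma flow_rank_lt u (v : symb) : precedes u v -> (flow_rank v < flow_rank u)%N.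
Proof.
move=> uv; apply: proper_card; apply/properP; split.
  by apply/subsetP => w; rewrite !inE; exact: precedes_trans uv.
by exists v => //; rewrite inE precedes_irr.
Qed.

(** If f is smaller than e, it was a member that is not toggleable, and it turns
    into a non-member that is not toggleable.  If f is larger, then e loses its
    toggleability: otherwise e would be the pivot of the new symbol and belong to
    it.  In both cases the smaller edges stay as they are, since none of them is
    toggleable before the step or after it. *)
Lemma gradient_step_precedes (u : symb) e f g : is_symbol T u ->
  pivot u = Some e -> e \notin u -> f \in edges T -> f != e ->
  f \in u -> pivot ((e |: u) :\ f) = Some g -> g \notin (e |: u) :\ f ->
  precedes u ((e |: u) :\ f).
Proof.
move=> us pu eu fT fe fu; set v := _ :\ f => pv gv.
have /pivotP[te emax] : pivot u == Some e by rewrite pu.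
have /pivotP[tg gmax] : pivot v == Some g by rewrite pv.
have eT := edge_toggleable_edge te.
have us1 : is_symbol T (e |: u) by exact: symbolU1.
have notu h : (code e < code h)%N -> edge_toggleable u h = false.
  by move=> lt; apply/negbTE/negP => /emax; rewrite leqNgt lt.
have notu1 h : (code e < code h)%N -> edge_toggleable (e |: u) h = false.
  move=> lt; apply/negbTE/negP => /(edge_toggleable_insert us te lt).
  by rewrite notu.
have notv h : (code e < code h)%N -> (code f < code h)%N ->
    edge_toggleable v h = false.
  by move=> lt lt'; apply/negbTE/negP => /(edge_toggleable_remove us1 fT lt'); rewrite notu1.
have mem_v h : h != e -> h != f -> (h \in v) = (h \in u).
  by move=> he hf; rewrite /v in_setD1 in_setU1 hf (negPf he).
have ne_code h k : (code k < code h)%N -> h != k.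
  by move=> lt; apply: contraTneq lt => ->; rewrite ltnn.
case: (ltngtP (code f) (code e)) => c; last first.
- by move: fe; rewrite (code_inj fT eT c) eqxx.
- apply/precedesP; exists f; split=> //.
    rewrite /activity notu // fu.
    have -> : edge_toggleable v f = false.
      apply/negbTE/negP => /(@toggle_self _ (e |: u) _ (symbolD1 f us1)).
      rewrite notu1 //; have h nu : nu != f -> (nu \in v) = (nu \in e |: u).
        by move=> ne; rewrite in_setD1 ne.
      by move=> /(_ h).
    by rewrite /v in_setD1 eqxx.
  move=> h hT fh; have eh := ltn_trans c fh.
  by rewrite /activity notu // notv // mem_v ?ne_code.
have ev : e \in v by rewrite in_setD1 eq_sym fe setU11.
have ge : edge_toggleable v e = false.
  apply/negbTE/negP => /gmax; rewrite leq_eqVlt => /orP[/eqP eg|lt].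
    by move: gv; rewrite -(code_inj eT (edge_toggleable_edge tg) eg) ev.
  by move: tg; rewrite notv // (ltn_trans c).
apply/precedesP; exists e; split=> //; first by rewrite /activity te ge ev.
move=> h hT eh; have fh := ltn_trans c eh.
by rewrite /activity notu // notv // mem_v ?ne_code.
Qed.

(** If both endpoints of e lay in other members, e would be a bridge, and a symbol
    with a bridge has a pivot. *)
Lemma private_endpoint (u : symb) e : is_symbol T u -> pivot u = None -> e \in u ->
  exists2 i, i \in e & forall mu, mu \in u -> i \in mu -> mu = e.
Proof.
move=> us pu eu; have /edgesP[x [z [p ee]]] := symbol_edge us eu.
have private i j : [set i; j] = e -> (forall k, k != j -> [set i; k] \notin u) ->
    forall mu, mu \in u -> i \in mu -> mu = e.
  move=> eij h mu muu imu; case/edgesP: (symbol_edge us muu) => a [b [pab emu]].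
  have [k ek] : exists k, mu = [set i; k].
    move: imu; rewrite emu !inE => /orP[/eqP ->|/eqP ->]; [by exists b|exists a].
    exact: setUC.
  have [kj|kj] := eqVneq k j; first by rewrite ek kj.
  by have := h k kj; rewrite -ek muu.
have [/existsP[w /andP[wx zw]]|nw] := boolP [exists w, (w != x) && ([set z; w] \in u)].
  have [/existsP[y /andP[yz xy]]|ny] := boolP [exists y, (y != z) && ([set x; y] \in u)].
    have pw : parent z w by apply: child_of p (set2_edge (symbol_edge us zw)) wx.
    have : e \in bridges u.
      apply/bridgesP => //; exists x, z; split=> //; split; rewrite -?ee //.
        by exists w.
      by exists y.
    by case/(bridge_toggleable us) => nu; rewrite pivot_none.
  exists x; first by rewrite ee !inE eqxx.
  apply: private (esym ee) _ => k kz; apply/negP => xk; move/existsP: ny; apply.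
  by exists k; rewrite kz.
exists z; first by rewrite ee !inE eqxx orbT.
apply: (private z x) => [|k kx]; first by rewrite setUC.
by apply/negP => zk; move/existsP: nw; apply; exists k; rewrite kx.
Qed.

(** The components of a symbol without bridges are stars: x is the centre of one and
    m a leaf of it.  If the component is a single edge, its earlier endpoint is
    taken as the centre. *)
Definition star_at (u : symb) (x m : 'I_n) : bool :=
  [&& [set x; m] \in u, [forall mu in u, (m \in mu) ==> (mu == [set x; m])]
    & [exists mu in u, (x \in mu) && (mu != [set x; m])] || vgt s x m].

Lemma star_atP (u : symb) x m : star_at u x m ->
  [/\ [set x; m] \in u, forall mu, mu \in u -> m \in mu -> mu = [set x; m]
    & (exists2 mu, mu \in u & (x \in mu) && (mu != [set x; m])) \/ vgt s x m].
Proof.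
move=> /and3P[xm /forallP h1 h2]; split=> //.
  by move=> mu muu mmu; have := h1 mu; rewrite muu mmu => /eqP.
by case/orP: h2 => [/existsP[mu /andP[? ?]]|]; [left; exists mu|right].
Qed.

Lemma star_at_leaf_center (u : symb) x m m' : is_symbol T u ->
  star_at u x m -> star_at u m m' -> False.
Proof.
move=> us /star_atP[xm hm hx] /star_atP[mm' hm' hm2].
have e : [set m; m'] = [set x; m] by apply: hm => //; rewrite !inE eqxx.
have Txm := set2_edge (symbol_edge us xm).
have nxm : x != m by apply: contraTneq Txm => ->; rewrite T_irr.
have m'x : m' = x.
  have : x \in [set m; m'] by rewrite e !inE eqxx.
  by rewrite !inE (negPf nxm) => /eqP.
rewrite m'x in e hm' hm2.
case: hm2 => [[mu muu /andP[mmu /eqP]]|mx]; first by rewrite e; case; exact: hm.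
case: hx => [[mu muu /andP[xmu /eqP]]|xm']; last first.
  by move: mx xm'; rewrite !vgtE => /ltn_trans h /h; rewrite ltnn.
by rewrite -e; case; exact: hm'.
Qed.

Lemma star_at_exists (u : symb) e : is_symbol T u -> pivot u = None -> e \in u ->
  exists x m, e = [set x; m] /\ star_at u x m.
Proof.
move=> us pu eu; have /edgesP[x [z [p ee]]] := symbol_edge us eu.
have pr i : (forall mu, mu \in u -> i \in mu -> mu = e) ->
    [forall mu in u, (i \in mu) ==> (mu == e)].
  move=> h; apply/forallP => mu; apply/implyP => muu; apply/implyP => imu.
  by rewrite (h mu muu imu).
have [i ie ip] := private_endpoint us pu eu.
move: ie; rewrite ee !inE => /orP[/eqP ix|/eqP iz]; last first.
  have [] : star_at u x z \/ ~~ star_at u x z by case: star_at; [left|right].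
    by exists x, z.
  by rewrite /star_at -ee eu pr -?iz //= iz (andP p).2 orbT.
have [/existsP[mu /and3P[muu zmu ne]]|no] :=
    boolP [exists mu in u, (z \in mu) && (mu != e)].
  exists z, x; split; first exact: setUC.
  rewrite /star_at setUC -ee eu pr -?ix //=; apply/orP; left.
  by apply/existsP; exists mu; rewrite muu zmu.
exists x, z; split=> //; rewrite /star_at -ee eu (andP p).2 orbT andbT /=.
apply: pr => mu muu zmu; apply/eqP; apply: contraT => ne.
by move/existsP: no; case; exists mu; rewrite muu zmu.
Qed.

Lemma star_at_isleaf (u : symb) x m : is_symbol T u -> star_at u x m -> leaf u m || parent m x.
Proof.
move=> us st; have [xm hm _] := star_atP st.
have [_|nmx] := boolP (parent m x); first exact: orbT.
rewrite orbF; apply/leafP => v pv; apply/negP => mv.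
have e : [set m; v] = [set x; m] by apply: hm => //; rewrite !inE eqxx.
have : v \in [set x; m] by rewrite -e !inE eqxx orbT.
rewrite !inE => /orP[/eqP vx|/eqP vm]; first by rewrite -vx pv in nmx.
by have := parent_lt pv; rewrite vm ltnn.
Qed.

Lemma no_pivot_not_toggleable (u : symb) x z : pivot u = None ->
  toggleable u x z -> False.
Proof.
move=> pu t; have := pivot_none [set x; z] pu.
by rewrite edge_toggleableE ?t //; case/toggleableP: t.
Qed.

(** If the centres x and y were adjacent, {x, y} would be toggleable, with leaves of
    the two stars at the ends of the path. *)
Lemma star_at_apart (u : symb) x a y b : is_symbol T u -> pivot u = None ->
  star_at u x a -> star_at u y b -> parent x y -> False.
Proof.
move=> us pu sx sy p; apply: (no_pivot_not_toggleable pu (x := x) (z := y)).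
have [xa ha _] := star_atP sx; have [yb hb _] := star_atP sy.
have by_ : b != x.
  by apply/eqP => e; rewrite e in sy; exact: star_at_leaf_center us sy sx.
have ay : a != y.
  by apply/eqP => e; rewrite e in sx; exact: star_at_leaf_center us sx sy.
have pb : parent y b by apply: child_of p (set2_edge (symbol_edge us yb)) by_.
apply/toggleableP; split=> //.
  exists b; split=> //; case/orP: (star_at_isleaf us sy) => // h.
  by have := parent_lt h; have := parent_lt pb; move=> h1 /(ltn_trans h1); rewrite ltnn.
exists a; split=> //; case/orP: (star_at_isleaf us sx) => [->|h]; first exact: orbT.
by rewrite vgtE (ltn_trans (parent_lt h) (parent_lt p)).
Qed.

(** If the later centre y were adjacent to the leaf m of x, then m would be its
    parent, and {m, y} would be toggleable with x as a neighbour of m before y. *)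
Lemma star_at_order (u : symb) x m y b : is_symbol T u -> pivot u = None ->
  star_at u x m -> star_at u y b -> T y m -> vgt s x y -> False.
Proof.
move=> us pu sx sy Tym xy.
have [xm hm _] := star_atP sx; have [yb hb _] := star_atP sy.
have Txm := set2_edge (symbol_edge us xm).
have nxy : x != y by apply: contraTneq xy => ->; rewrite vgtE ltnn.
have nmy : m != y by apply: contraTneq Tym => ->; rewrite T_irr.
have [ypm|npm] := boolP (parent y m).
  have pmx : parent m x by apply: child_of ypm _ nxy; rewrite T_sym.
  have := ltn_trans (parent_lt ypm) (parent_lt pmx).
  by move/(ltn_trans xy); rewrite ltnn.
have pmy : parent m y.
  rewrite /parent T_sym Tym; case/orP: (vgt_tot nmy) => // h.
  by rewrite /parent Tym h in npm.
apply: (no_pivot_not_toggleable pu (x := m) (z := y)).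
have bm : b != m.
  apply: contraNneq nxy => e; rewrite e in yb.
  have : [set y; m] = [set x; m] by apply: hm => //; rewrite !inE eqxx orbT.
  move/setP/(_ y); rewrite !inE eqxx /= => /esym/orP[/eqP ->//|/eqP ym].
  by rewrite ym eqxx in nmy.
have pb : parent y b by apply: child_of pmy (set2_edge (symbol_edge us yb)) bm.
apply/toggleableP; split=> //.
  exists b; split=> //; case/orP: (star_at_isleaf us sy) => // h.
  by have := parent_lt h; have := parent_lt pb; move=> h1 /(ltn_trans h1); rewrite ltnn.
by exists x; rewrite setUC xm xy.
Qed.

Lemma F_admissible_symbol (u : symb) : F_admissible T s u -> is_symbol T u.
Proof.
case/andP => /existsP[W /andP[_ uW]] _; apply: subset_trans uW _.
apply/subsetP => mu; rewrite inE => /andP[/bigcupP[x _]] + _.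
by rewrite inE => /andP[].
Qed.

(** The centres of the stars form a selection that retains every edge of u. *)
Lemma no_pivot_admissible (u : symb) : is_symbol T u -> pivot u = None ->
  F_admissible T s u.
Proof.
move=> us pu; apply/andP; split; last first.
  by apply/negP => /(has_gap_toggleable us)[mu]; rewrite pivot_none.
pose W := [set x | [exists m, star_at u x m]].
apply/existsP; exists W; apply/andP; split.
  apply/forallP => x; apply/implyP; rewrite inE => /existsP[a sx].
  apply/forallP => y; apply/implyP; rewrite inE => /existsP[b sy].
  apply/negP => Txy; have /vgt_tot/orP[h|h] : x != y.
      by apply: contraTneq Txy => ->; rewrite T_irr.
    by apply: (star_at_apart us pu sx sy); rewrite /parent Txy.
  by apply: (star_at_apart us pu sy sx); rewrite /parent T_sym Txy.
apply/subsetP => mu muu; have muT := symbol_edge us muu.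
have [x [m [emu sx]]] := star_at_exists us pu muu.
have xW : x \in W by rewrite inE; apply/existsP; exists m.
have mW : m \notin W.
  by apply/negP; rewrite inE => /existsP[m' sm]; exact: star_at_leaf_center us sx sm.
rewrite inE; apply/andP; split.
  by apply/bigcupP; exists x => //; rewrite inE muT emu !inE eqxx.
apply/existsP => -[x' /andP[x'W /existsP[y /and4P[yW]]]].
rewrite inE muT /= => x'mu xy /existsP[nu /andP[]].
have ex : x' = x.
  move: x'mu; rewrite emu !inE => /orP[/eqP //|/eqP e].
  by rewrite -e x'W in mW.
rewrite {x' x'W x'mu}ex in xy *.
move: (yW); rewrite inE => /existsP[b sy].
rewrite inE => /andP[nuT ynu] /pred0Pn[q /andP[/= qmu qnu]].
have nxy : x != y by apply: contraTneq xy => ->; rewrite vgtE ltnn.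
have [yq|ne] := eqVneq y q.
  move: qmu; rewrite -yq emu !inE [y == x]eq_sym (negPf nxy) => /eqP ym.
  by rewrite -ym yW in mW.
have Tyq : T y q.
  case/edgesP: nuT ynu qnu => a [c [pac ->]]; rewrite !inE.
  case/orP => /eqP y_ /orP[] /eqP q_; move: ne; rewrite y_ q_ ?eqxx // => _.
    exact: parentT.
  by rewrite T_sym parentT.
move: qmu; rewrite emu !inE => /orP[/eqP qx|/eqP qm]; last first.
  by rewrite qm in Tyq; exact: star_at_order us pu sx sy Tyq xy.
by apply: (star_at_apart us pu sx sy); rewrite /parent T_sym -qx Tyq qx.
Qed.

Lemma pruned_star (W : {set 'I_n}) a b : selectable T W -> [set a; b] \in pruned T s W ->
  a \in W /\ b \notin W \/ b \in W /\ a \notin W.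
Proof.
move=> /forallP selW; rewrite inE => /andP[/bigcupP[x xW]].
rewrite inE => /andP[ab xab] _.
have Tab := set2_edge ab.
have indep c d : c \in W -> T c d -> d \notin W.
  move=> cW Tcd; apply/negP => dW; have := selW c; rewrite cW => /forallP/(_ d).
  by rewrite dW Tcd.
move: xab; rewrite !inE => /orP[/eqP e|/eqP e]; rewrite -e; [left|right]; split=> //.
  by apply: (indep x) => //; rewrite e.
by apply: (indep x) => //; rewrite e T_sym.
Qed.

(** The later of two selected neighbours of a cancels the edge from the earlier one
    to a. *)
Lemma pruned_order (W : {set 'I_n}) x a w : x \in W -> w \in W ->
  [set x; a] \in pruned T s W -> [set a; w] \in pruned T s W -> ~~ vgt s x w.
Proof.
move=> xW wW; rewrite inE => /andP[/bigcupP[x0 _ xa] nx].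
rewrite inE => /andP[/bigcupP[w0 _ aw] _]; apply/negP => xw; move/existsP: nx; apply.
exists x; rewrite xW; apply/existsP; exists w; rewrite wW xw.
move: xa aw; rewrite ![_ \in star _ _]inE => /andP[-> _] /andP[aw _].
rewrite !inE eqxx /=; apply/existsP; exists [set a; w].
rewrite inE aw !inE eqxx orbT /=; apply/pred0Pn; exists a.
by rewrite /= !inE !eqxx orbT.
Qed.

Lemma pruned_no_path (W : {set 'I_n}) x a w : x \in W -> w \in W -> x != w ->
  [set x; a] \in pruned T s W -> [set a; w] \in pruned T s W -> False.
Proof.
move=> xW wW ne xa aw; have h1 := pruned_order xW wW xa aw.
rewrite setUC in xa; rewrite setUC in aw; have h2 := pruned_order wW xW aw xa.
by case/orP: (vgt_tot ne) => h; [rewrite h in h1|rewrite h in h2].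
Qed.

(** A toggleable edge that is absent is the bridge of a gap.  One that is present is
    the middle of a path of three members; two selected vertices with a common
    neighbour lie on that path, so one of the members was cancelled. *)
Lemma admissible_no_pivot (u : symb) : F_admissible T s u -> pivot u = None.
Proof.
move=> adm; have us := F_admissible_symbol adm.
case/andP: adm => /existsP[W /andP[selW /subsetP uW]] ngap.
case e: (pivot u) => [mu|//].
have /pivotP[t _] : pivot u == Some mu by rewrite e.
have [muu|nmu] := boolP (mu \in u); last first.
  by move: ngap; rewrite (toggleable_gap us nmu t).
case/edge_toggleableP: t => x [z [emu /toggleableP[p [w [pw zw _]] [y [ne xy _]]]]].
rewrite emu in muu; have xzW := uW _ muu; have zwW := uW _ zw; have xyW := uW _ xy.
have xz := parent_lt p; have zw_lt := parent_lt pw.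
have nxw : x != w by rewrite pos_eqE neq_ltn (ltn_trans xz zw_lt).
case: (pruned_star selW xzW) => -[inW outW]; exfalso.
  have wW : w \in W.
    by case: (pruned_star selW zwW) => -[// zW]; rewrite zW in outW.
  exact: (pruned_no_path inW wW nxw xzW zwW).
have yW : y \in W.
  by case: (pruned_star selW xyW) => -[// xW]; rewrite xW in outW.
by apply: (pruned_no_path yW inW ne _ xzW); rewrite setUC.
Qed.

Lemma F_admissibleE (u : symb) : F_admissible T s u = is_symbol T u && (toggle u == u).
Proof.
apply/idP/andP => [adm|[us /eqP e]].
  have us := F_admissible_symbol adm; split=> //.
  by rewrite /toggle us admissible_no_pivot.
apply: no_pivot_admissible => //; move: e; rewrite /toggle us.
case: (pivot u) => // mu; case: ifP => muu /setP/(_ mu).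
  by rewrite muu in_setD1 eqxx.
by rewrite muu setU11.
Qed.

End Matching.

Import GRing.Theory Num.Theory.
Local Open Scope ring_scope.

(** * Algebraic discrete Morse theory *)

Section AlgebraicMorse.

Context (R : comNzRingType) (X : finType) (sz : X -> nat) (d : X -> X -> R).
Context (tau : X -> X) (G : X -> X -> R) (rk : X -> nat).

(** The involution tau pairs every cell that is not critical with one of adjacent
    size. *)
Definition critical (a : X) := tau a == a.
Definition lower (a : X) := (sz a < sz (tau a))%N.
Definition upper (a : X) := (sz (tau a) < sz a)%N.

Definition boundary (z : X -> R) (w : X) : R := \sum_v z v * d v w.

Definition morse_diff (u c : X) : R := \sum_b d u b * G b c.

(** The image of a chain under the projection to critical cells that sends a cell to
    the ends, of the same size, of the gradient paths starting from it. *)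
Definition flow (z : X -> R) (c : X) : R := \sum_(a | sz a == sz c) z a * G a c.

Context (d_sz : forall u v, d u v != 0 -> sz u = (sz v).+1).
Context (d_d : forall u w, \sum_v d u v * d v w = 0).
Context (tauK : involutive tau) (tau_sz : forall a, sz (tau a) = sz a -> tau a = a).
Context (d_unit : forall a, lower a -> d (tau a) a * d (tau a) a = 1).
(* The recursion on the first step of a gradient path: G a c is a weighted number
   of paths from a to c, and matched facets are traversed upwards, with the
   opposite sign. *)
Context (G_lower : forall a c, critical c -> lower a ->
  G a c = \sum_b d a b * G b c - d (tau a) a * G (tau a) c).
Context (G_upper : forall a c, critical c -> upper a ->
  G a c = \sum_b d a b * G b c - d a (tau a) * G (tau a) c).
Context (G_crit : forall a c, critical c -> critical a ->
  G a c = (a == c)%:R + \sum_b d a b * G b c).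
Context (G_small : forall a c, critical c -> (sz a < sz c)%N -> G a c = 0).
Context (G_upper0 : forall a c, critical c -> upper a -> sz a = sz c -> G a c = 0).
(* Acyclicity: the rank decreases when a path goes from a lower cell up to its
   partner u and down to another lower cell b. *)
Context (rk_lt : forall u b, upper u -> lower b -> b != tau u -> d u b != 0 ->
  (rk b < rk (tau u))%N).

Lemma trichotomy a : [\/ lower a, upper a | critical a].
Proof.
rewrite /lower /upper /critical; case: ltngtP => [||e]; try by constructor.
by constructor 3; rewrite tau_sz.
Qed.

Lemma lower_tau a : lower (tau a) = upper a.
Proof. by rewrite /lower /upper tauK. Qed.

Lemma upper_tau a : upper (tau a) = lower a.
Proof. by rewrite /lower /upper tauK. Qed.

Lemma lower_crit a : lower a -> critical a = false.
Proof.
by rewrite /lower /critical => h; apply/negP => /eqP e; rewrite e ltnn in h.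
Qed.

Lemma upper_crit a : upper a -> critical a = false.
Proof.
by rewrite /upper /critical => h; apply/negP => /eqP e; rewrite e ltnn in h.
Qed.

Lemma dG_small u c : critical c -> (sz u <= sz c)%N -> \sum_b d u b * G b c = 0.
Proof.
move=> cc le; apply: big1 => b _; have [->|/d_sz e] := eqVneq (d u b) 0.
  by rewrite mul0r.
by rewrite G_small ?mulr0 // -ltnS -e ltnS.
Qed.

Lemma G_crit_same a c : critical c -> critical a -> sz a = sz c ->
  G a c = (a == c)%:R.
Proof. by move=> cc ca e; rewrite G_crit // dG_small ?e // addr0. Qed.

Lemma tau_d_sz a : lower a -> sz (tau a) = (sz a).+1.
Proof.
move=> la; apply: d_sz; apply/eqP => e; move: (d_unit la).
by rewrite e mul0r => /esym/eqP; rewrite oner_eq0.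
Qed.

(** The recursions for G at t and at its lower partner, substituted into each other,
    leave this sum alone. *)
Lemma dG_upper t c : critical c -> upper t -> sz t = (sz c).+1 ->
  \sum_b d t b * G b c = 0.
Proof.
move=> cc ut e; have la : lower (tau t) by rewrite lower_tau.
have st : sz t = (sz (tau t)).+1 by rewrite -[in LHS](tauK t) tau_d_sz.
have := G_lower cc la; rewrite tauK dG_small //; last first.
  by rewrite -ltnS -st e.
rewrite (G_upper cc ut) mulrBr mulrA.
have -> : d t (tau t) * d t (tau t) = 1 by have := d_unit la; rewrite tauK.
rewrite mul1r sub0r opprB => /eqP; rewrite eq_sym subr_eq addrC -subr_eq subrr.
move=> /eqP /(congr1 ( *%R (d t (tau t)))); rewrite mulr0 mulrA.
have -> : d t (tau t) * d t (tau t) = 1 by have := d_unit la; rewrite tauK.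
by rewrite mul1r => <-.
Qed.

(** The two sides agree on critical cells by definition, and vanish on upper cells.
    If a is lower, both vanish on the boundary of tau a, in which a has an
    invertible coefficient and the other lower cells have smaller rank. *)
Lemma flow_d a c : critical c -> sz a = (sz c).+1 ->
  \sum_b d a b * G b c =
  \sum_(u | critical u && (sz u == sz a)) G a u * morse_diff u c.
Proof.
move=> cc; have [m] := ubnP (rk a); elim: m a => // m IH a rka sa.
case: (trichotomy a) => [la|ua|ca]; last 2 first.
- rewrite dG_upper // big1 // => u /andP[cu /eqP su].
  by rewrite G_upper0 ?mul0r.
- rewrite [RHS](bigD1 a) ?ca ?eqxx //= [X in _ + X]big1 ?addr0.
    by rewrite G_crit_same // eqxx mul1r.
  move=> u /andP[/andP[cu /eqP su] ne].
  by rewrite G_crit_same // eq_sym (negPf ne) mul0r.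
set E := fun a => \sum_(u | critical u && (sz u == sz a)) G a u * morse_diff u c.
pose D a := \sum_b d a b * G b c.
rewrite -/(D a) -/(E a).
have ut : upper (tau a) by rewrite upper_tau.
have st := tau_d_sz la.
have D0 : \sum_b d (tau a) b * D b = 0.
  rewrite /D; under eq_bigr do rewrite mulr_sumr.
  rewrite exchange_big big1 // => e _.
  by under eq_bigr do rewrite mulrA; rewrite -mulr_suml d_d mul0r.
have E0 : \sum_b d (tau a) b * E b = 0.
  transitivity (\sum_b \sum_(u | critical u && (sz u == sz a))
      d (tau a) b * (G b u * morse_diff u c)).
    apply: eq_bigr => b _; rewrite /E mulr_sumr.
    have [->|/d_sz e] := eqVneq (d (tau a) b) 0.
      by rewrite [RHS]big1 ?big1 // => *; rewrite mul0r.
    by move: e; rewrite st => -[->].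
  rewrite exchange_big big1 // => u /andP[cu /eqP su].
  under eq_bigr do rewrite mulrA.
  by rewrite -mulr_suml dG_upper ?mul0r // st su.
have : \sum_b d (tau a) b * (D b - E b) = 0.
  by under eq_bigr do rewrite mulrBr; rewrite sumrB D0 E0 subrr.
rewrite (bigD1 a) //= [X in _ + X]big1 ?addr0.
  move=> /(congr1 ( *%R (d (tau a) a))); rewrite mulr0 mulrA d_unit // mul1r.
  by move/eqP; rewrite subr_eq0 => /eqP.
move=> b ne; have [->|db] := eqVneq (d (tau a) b) 0; first by rewrite mul0r.
have sb : sz b = (sz c).+1 by move: (d_sz db); rewrite st sa => -[].
suff -> : D b = E b by rewrite subrr mulr0.
case: (trichotomy b) => [lb|ub|cb].
- apply: IH => //; have := rk_lt ut lb; rewrite tauK => /(_ ne db) h.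
  by apply: leq_trans h _; rewrite -ltnS.
- rewrite /D dG_upper // /E big1 // => u /andP[cu /eqP su].
  by rewrite G_upper0 ?mul0r.
rewrite /E (bigD1 b) ?cb ?eqxx //= [X in _ + X]big1 ?addr0.
  by rewrite G_crit_same // eqxx mul1r.
move=> u /andP[/andP[cu /eqP su] ne'].
by rewrite G_crit_same // eq_sym (negPf ne') mul0r.
Qed.

Lemma flow_boundary z c : critical c ->
  flow (boundary z) c =
  \sum_(u | critical u && (sz u == (sz c).+1)) flow z u * morse_diff u c.
Proof.
move=> cc; transitivity (\sum_(a | sz a == (sz c).+1) z a * \sum_b d a b * G b c).
  rewrite /flow /boundary; under eq_bigr do rewrite mulr_suml.
  rewrite exchange_big [RHS]big_mkcond /=; apply: eq_bigr => a _.
  case: ifP => sa.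
    rewrite mulr_sumr [RHS](bigID (fun b => sz b == sz c)) /= [X in _ = _ + X]big1.
      by rewrite addr0; apply: eq_bigr => b _; rewrite mulrA.
    move=> b sb; have [->|/d_sz e] := eqVneq (d a b) 0.
      by rewrite mul0r mulr0.
    by move: sa; rewrite e eqSS (negPf sb).
  apply: big1 => b sb; have [->|/d_sz e] := eqVneq (d a b) 0.
    by rewrite mulr0 mul0r.
  by move: sa; rewrite e (eqP sb) eqxx.
transitivity (\sum_(a | sz a == (sz c).+1)
    \sum_(u | critical u && (sz u == (sz c).+1)) z a * (G a u * morse_diff u c)).
  apply: eq_bigr => a /eqP sa; rewrite flow_d // mulr_sumr.
  by rewrite sa.
rewrite exchange_big; apply: eq_bigr => u /andP[_ /eqP su].
rewrite /flow su mulr_suml; apply: eq_bigr => a _; by rewrite mulrA.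
Qed.

Lemma boundaryB z k w : boundary (fun v => z v - k v) w = boundary z w - boundary k w.
Proof. by rewrite /boundary -sumrB; apply: eq_bigr => v _; rewrite mulrBl. Qed.

Lemma boundary_boundary z w : boundary (boundary z) w = 0.
Proof.
rewrite /boundary; under eq_bigr do rewrite mulr_suml.
rewrite exchange_big big1 // => v _; under eq_bigr do rewrite -mulrA.
by rewrite -mulr_sumr d_d mulr0.
Qed.

Lemma flow_crit z c : critical c -> (forall v, lower v -> z v = 0) ->
  flow z c = z c.
Proof.
move=> cc z0; rewrite /flow (bigD1 c) //= G_crit_same // eqxx mulr1.
rewrite big1 ?addr0 // => a /andP[/eqP sa ne].
case: (trichotomy a) => [/z0->|ua|ca]; first by rewrite mul0r.
  by rewrite G_upper0 ?mulr0.
by rewrite G_crit_same // (negPf ne) mulr0.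
Qed.

(** The boundary of tau a contains a with an invertible coefficient, and other lower
    cells with smaller rank: lower cells can be cleared from the top rank down. *)
Lemma clear_lower z : exists2 k, (forall v, ~~ upper v -> k v = 0)
  & forall a, lower a -> z a = boundary k a.
Proof.
suff [k k0 kP] : exists2 k, (forall v, ~~ upper v -> k v = 0)
    & forall a, lower a -> (0 <= rk a)%N -> z a = boundary k a.
  by exists k => // a la; exact: kP.
have := leq0n (\max_a rk a).+1; move: {1 3}0%N => m.
move=> mM; have [j] := ubnP ((\max_a rk a).+1 - m).
elim: j m mM => // j IH m mM jm.
have [e|ne] := eqVneq m (\max_a rk a).+1.
  exists (fun=> 0) => // a _; rewrite e => h; suff: (rk a < rk a)%N by rewrite ltnn.
  by apply: leq_trans h; rewrite ltnS; exact: leq_bigmax.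
have mM' : (m < (\max_a rk a).+1)%N by rewrite ltn_neqAle ne.
have [|k k0 kP] := IH m.+1 mM'.
  by rewrite -ltnS; apply: leq_trans jm; rewrite ltnS ltn_sub2l.
pose k' v := if upper v && (rk (tau v) == m) then
  d v (tau v) * (z (tau v) - boundary k (tau v)) else 0.
exists (fun v => k v + k' v).
  by move=> v uv; rewrite k0 // /k' (negPf uv) addr0.
move=> a la ma; have -> : boundary (fun v => k v + k' v) a = boundary k a + boundary k' a.
  by rewrite /boundary -big_split; apply: eq_bigr => v _; rewrite mulrDl.
have ut : upper (tau a) by rewrite upper_tau.
rewrite {2}/boundary (bigD1 (tau a)) //= [X in _ + (_ + X)]big1 => [|v ne'].
  rewrite addr0 /k' ut tauK; case: eqP => e.
    by rewrite mulrAC d_unit // mul1r addrC subrK.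
  rewrite mul0r addr0; apply: kP => //.
  by rewrite ltn_neqAle ma eq_sym; case: eqP e.
rewrite /k'; case: ifP => [/andP[uv /eqP e]|_]; last by rewrite mul0r.
have [->|dv] := eqVneq (d v a) 0; first by rewrite mulr0.
have : (rk a < rk (tau v))%N.
  by apply: rk_lt => //; apply: contraNneq ne' => ->; rewrite tauK.
by rewrite e ltnNge ma.
Qed.

(** In the coefficient at tau v of a boundary, v competes with upper cells whose
    partners have larger rank, so the coefficients vanish from the top rank down. *)
Lemma upper_cycle z : (forall v, ~~ upper v -> z v = 0) ->
  (forall w, boundary z w = 0) -> forall v, z v = 0.
Proof.
move=> z0 bz v; have [uv|/z0 //] := boolP (upper v).
have [j] := ubnP ((\max_a rk a) - rk (tau v)).
elim: j v uv => // j IH v uv jv.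
have lt : lower (tau v) by rewrite lower_tau.
have := bz (tau v); rewrite /boundary (bigD1 v) //= [X in _ + X]big1.
  rewrite addr0 => /(congr1 ( *%R^~ (d v (tau v)))); rewrite mul0r -mulrA.
  by have := d_unit lt; rewrite tauK => ->; rewrite mulr1.
move=> u ne; have [uu|/z0 ->] := boolP (upper u); last by rewrite mul0r.
have [->|du] := eqVneq (d u (tau v)) 0; first by rewrite mulr0.
rewrite IH ?mul0r //; have := rk_lt uu lt _ du.
rewrite (inj_eq (inv_inj tauK)) eq_sym ne => /(_ isT) h.
rewrite -ltnS; apply: leq_trans jv; rewrite ltnS; apply: ltn_sub2l => //.
by apply: leq_trans h _; exact: leq_bigmax.
Qed.

(** Subtract from the boundary of f a boundary of upper cells that has the same lower
    part.  The critical part of the difference is its flow, which vanishes; a cycle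
    of upper cells is left, and it is zero. *)
Lemma critical_cycle_lift f : (forall v, ~~ critical v -> f v = 0) ->
  (forall c, critical c ->
     \sum_(u | critical u && (sz u == (sz c).+1)) f u * morse_diff u c = 0) ->
  exists k, [/\ forall v, ~~ upper v -> k v = 0,
    forall w, boundary (fun v => f v - k v) w = 0
  & forall c, critical c -> flow (fun v => f v - k v) c = f c].
Proof.
move=> f0 df; have fl v : lower v -> f v = 0.
  by move=> lv; rewrite f0 // lower_crit.
have [k k0 kP] := clear_lower (boundary f).
have kl v : lower v -> k v = 0.
  by move=> lv; apply: k0; rewrite /upper -leqNgt ltnW.
exists k; split => // [w|c cc]; last first.
  rewrite flow_crit //; first by rewrite k0 ?subr0 // /upper (eqP cc) ltnn.
  by move=> v lv; rewrite fl // kl // subrr.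
set g := fun v => _; apply: (@upper_cycle (boundary g)) => {w}; last first.
  by move=> w; exact: boundary_boundary.
have gl v : lower v -> boundary g v = 0 by move=> lv; rewrite boundaryB kP // subrr.
move=> c; case: (trichotomy c) => [/gl//|->//|cc] _.
rewrite -flow_crit // flow_boundary // -[RHS](df c cc).
apply: eq_bigr => u /andP[cu _]; congr (_ * _).
rewrite flow_crit // /g; first by rewrite k0 ?subr0 // /upper (eqP cu) ltnn.
by move=> v lv; rewrite fl // kl // subrr.
Qed.

Lemma morse_diff_comp u c : critical u -> critical c -> sz u = (sz c).+2 ->
  \sum_(v | critical v && (sz v == (sz c).+1)) morse_diff u v * morse_diff v c = 0.
Proof.
move=> cu cc su; have := @flow_boundary (d u) c cc.
have -> : flow (boundary (d u)) c = 0.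
  by rewrite /flow big1 // => a _; rewrite /boundary d_d mul0r.
move=> {2}->; apply: eq_bigr => v /andP[cv /eqP sv]; congr (_ * _).
rewrite /flow /morse_diff [LHS](bigID (fun b => sz b == sz v)) /= [X in _ + X]big1.
  by rewrite addr0.
move=> b sb; have [->|/d_sz e] := eqVneq (d u b) 0; first by rewrite mul0r.
by move: sb; rewrite sv -eqSS -su e eqxx.
Qed.

End AlgebraicMorse.

(** * Sums over gradient paths *)

Section GradientPaths.

Context (n : nat) (T : rel 'I_n) (s : seq 'I_n).
Local Notation symb := {set {set 'I_n}}.
Local Notation step := (grad_step T s).
Local Notation weight := (step_weight T s).

Definition walk_sum (t : nat) (a c : symb) : int :=
  \sum_(p : t.-tuple symb | path step a p && (last a p == c)) path_weight T s a p.

Lemma walk_sum0 a c : walk_sum 0 a c = (a == c)%:R.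
Proof.
rewrite /walk_sum; case: eqP => e.
  by rewrite (big_pred1 [tuple]) ?e // => p; rewrite (tuple0 p) /= !eqxx.
by rewrite big1 // => p; rewrite (tuple0 p) /=; case: eqP.
Qed.

Lemma walk_sumS t a c :
  walk_sum t.+1 a c = \sum_(b | step a b) weight a b * walk_sum t b c.
Proof.
rewrite /walk_sum; under [RHS]eq_bigr do rewrite mulr_sumr.
rewrite pair_big_dep /=.
rewrite (reindex (fun bp : symb * t.-tuple symb => cons_tuple bp.1 bp.2)) /=.
  by apply: eq_bigl => -[b p] /=; rewrite andbA.
exists (fun p : t.+1.-tuple symb => (thead p, behead_tuple p)).
  by move=> [b p] _ /=; congr (_, _); apply: val_inj.
by move=> p _; rewrite [RHS]tuple_eta; apply: val_inj.
Qed.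

Lemma walk_sum_eq0 t a c :
  (forall p, path step a p -> last a p != c) -> walk_sum t a c = 0.
Proof.
by move=> h; apply: big1 => p /andP[/h ne e]; rewrite e in ne.
Qed.

(** Along a walk the rank decreases, so a walk visits no symbol twice and the bound
    on its length in the definition is never reached. *)
Lemma grad_path_sumS (rho : symb -> nat) (a c : symb) :
  (forall u v, step u v -> (rho v < rho u)%N) ->
  grad_path_sum T s a c =
  (a == c)%:R + \sum_(b | step a b) weight a b * grad_path_sum T s b c.
Proof.
move=> rho_lt; rewrite /grad_path_sum -/(walk_sum _ _ _).
have long b : walk_sum #|{: symb}| b c = 0.
  rewrite /walk_sum big1 // => p /andP[pp _].
  have /card_uniqP : uniq (b :: p).
    apply: (@sorted_uniq _ [rel u v | (rho v < rho u)%N]) => [y x z /= h1 h2||].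
    - exact: ltn_trans h2 h1.
    - by move=> x /=; rewrite ltnn.
    by apply: sub_path pp => u v; exact: rho_lt.
  move: (max_card (mem (b :: p))) => le e; move: le.
  by rewrite e /= size_tuple ltnn.
under eq_bigr do rewrite -/(walk_sum _ a c).
have <- : \sum_(t < #|{: symb}|.+1) walk_sum t a c
   = \sum_(t < #|{: symb}|) walk_sum t a c by rewrite big_ord_recr /= long addr0.
rewrite big_ord_recl /= walk_sum0; congr (_ + _).
under eq_bigr do rewrite walk_sumS.
by rewrite exchange_big; apply: eq_bigr => b _; rewrite mulr_sumr.
Qed.

Lemma grad_path_sum_eq0 a c :
  (forall p, path step a p -> last a p != c) -> grad_path_sum T s a c = 0.
Proof. by move=> h; apply: big1 => t _; exact: walk_sum_eq0. Qed.

End GradientPaths.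

(** * Multidegrees and the Taylor complex *)

Section Multidegrees.

Context (n : nat).
Local Notation symb := {set {set 'I_n}}.

Lemma edge_monE (mu : {set 'I_n}) i : edge_mon mu i = (i \in mu).
Proof. by rewrite mnmE. Qed.

Lemma grE (u : symb) i : gr u i = (i \in cover u).
Proof.
rewrite /gr (big_morph (fun m : 'X_{1..n} => m i) (id1 := 0%N) (op1 := maxn));
  [|by move=> x y; rewrite mnmE|by rewrite mnmE].
under eq_bigr do rewrite edge_monE.
case: bigcupP => [[mu mu_u i_mu]|h].
  apply/eqP; rewrite eqn_leq; apply/andP; split.
    by apply/bigmax_leqP => nu _; exact: leq_b1.
  by apply: (bigmax_sup mu) => //; rewrite i_mu.
apply/eqP; rewrite -leqn0; apply/bigmax_leqP => mu mu_u.
by case: (boolP (i \in mu)) => // i_mu; case: h; exists mu.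
Qed.

Lemma gr_le (u v : symb) : (gr u <= gr v)%MM = (cover u \subset cover v).
Proof.
apply/mnm_lepP/subsetP => [h i iu|h i]; last first.
  by rewrite !grE; case: (boolP (i \in _)) => [/h->|].
by have := h i; rewrite !grE iu; case: (i \in _).
Qed.

Lemma gr0 : gr (set0 : symb) = 0%MM.
Proof. by rewrite /gr big_set0. Qed.

Lemma gr_U1 e (u : symb) (a : 'X_{1..n}) :
  (gr (e |: u) <= a)%MM = (edge_mon e <= a)%MM && (gr u <= a)%MM.
Proof.
have -> : gr (e |: u) = mlcm (edge_mon e) (gr u).
  apply/mnmP => i; rewrite mnmE edge_monE !grE /cover bigcup_setU big_set1 inE.
  by case: (_ \in e); case: (_ \in _).
by rewrite lem_mlcm.
Qed.

End Multidegrees.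

Section Taylor.

Context (n : nat) (T : rel 'I_n) (s : seq 'I_n).
Local Notation symb := {set {set 'I_n}}.
Local Notation S := (edge_seq T s).

Lemma edge_seq_uniq : uniq S.
Proof. by rewrite sort_uniq enum_uniq. Qed.

Lemma mem_edge_seq e : (e \in S) = (e \in edges T).
Proof. by rewrite mem_sort mem_enum. Qed.

Definition nb_before (e : {set 'I_n}) (u : symb) : nat :=
  count (mem u) (take (index e S) S).

Definition sgn (e : {set 'I_n}) (u : symb) : int := (-1) ^+ nb_before e u.

Lemma nb_beforeU1 e f (u : symb) : f \in edges T -> f \notin u ->
  nb_before e (f |: u) = (nb_before e u + (index f S < index e S))%N.
Proof.
move=> fT fu; rewrite /nb_before -(in_take (s := S)) ?mem_edge_seq //.
rewrite -count_uniq_mem ?take_uniq ?edge_seq_uniq // -count_predUI.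
rewrite [X in (_ = _ + X)%N](_ : _ = 0%N) ?addn0.
  by apply: eq_count => x /=; rewrite !inE orbC.
rewrite -(count_pred0 (take (index e S) S)); apply: eq_count => x /=.
by apply/negP => /andP[h /eqP e']; move: fu; rewrite -e' h.
Qed.

(** Inserting the earlier of e and f shifts the position of the later one, and not
    conversely. *)
Lemma sgn_swap e f (u : symb) : e \in edges T -> f \in edges T -> e != f ->
  e \notin u -> f \notin u ->
  sgn e (f |: u) * sgn f u = - (sgn f (e |: u) * sgn e u).
Proof.
move=> eT fT ne eu fu; rewrite /sgn -!exprD !nb_beforeU1 //.
have : index e S != index f S.
  apply: contraNneq ne => h; apply/eqP.
  by rewrite -(nth_index e (s := S) (x := e)) ?mem_edge_seq // h nth_index // mem_edge_seq.
case: ltngtP => // _ _; rewrite /= ?addn0 ?addn1.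
  by rewrite addnC !exprD !exprS !mulN1r ?mulrN ?mulNr ?opprK.
by rewrite addnC !exprD !exprS !mulN1r ?mulrN ?mulNr ?opprK.
Qed.

Lemma sgn_sq e u : sgn e u * sgn e u = 1.
Proof. by rewrite -expr2 sqrr_sign. Qed.

Lemma incidence_U1 e (w : symb) : e \in edges T -> e \notin w ->
  incidence T s (e |: w) w = sgn e w.
Proof.
move=> eT ew; rewrite /incidence /sgn !exprS !mulN1r opprK; congr (_ ^+ _).
rewrite /symb_seq -/S /nb_before.
have eS : e \in S by rewrite mem_edge_seq.
have ni : e \notin take (index e S) S by rewrite in_take // ltnn.
rewrite -[X in filter _ X](cat_take_drop (index e S)) filter_cat find_cat.
rewrite (drop_nth e) ?index_mem // nth_index //= setU11 /= ew addn0.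
have eqm : {in take (index e S) S, (mem (e |: w)) =1 (mem w)}.
  move=> x xt /=; rewrite !inE; suff /negPf -> : x != e by [].
  by apply: contraNneq ni => xe; rewrite -{1}xe.
rewrite ifN; first by rewrite size_filter; apply: eq_in_count.
apply/hasPn => x; rewrite mem_filter => /andP[xw xt].
by rewrite negbK; have := eqm x xt => /= <-.
Qed.

Definition taylor (v w : symb) : int :=
  if facet T v w then incidence T s v w else 0.

Lemma taylor_sum (A : pzRingType) (z : symb -> A) w : is_symbol T w ->
  \sum_v z v * (taylor v w)%:~R =
  \sum_(e in edges T :\: w) z (e |: w) * (sgn e w)%:~R.
Proof.
move=> sw; transitivity (\sum_(v in [set e |: w | e in edges T :\: w])
    z v * (incidence T s v w)%:~R).
  rewrite [RHS]big_mkcond; apply: eq_bigr => v _; rewrite /taylor.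
  have -> : facet T v w = (v \in [set e |: w | e in edges T :\: w]).
    apply/facetP/imsetP => [[_ [e [eT ew ->]]]|[e /setDP[eT ew] ->]].
      by exists e => //; rewrite inE ew.
    by split=> //; exists e.
  by case: ifP => // _; rewrite mulr0.
rewrite big_imset /=; last first.
  move=> e f /setDP[_ ew] /setDP[_ fw] h.
  have : e \in f |: w by rewrite -h setU11.
  by rewrite !inE (negPf ew) orbF => /eqP.
by apply: eq_bigr => e /setDP[eT ew]; rewrite incidence_U1.
Qed.

Lemma taylor_nsymb v w : ~~ is_symbol T w -> taylor v w = 0.
Proof. by rewrite /taylor; case: facetP => // -[->]. Qed.

(** Removing two edges in the two possible orders gives opposite signs. *)
Lemma taylor_taylor u w : \sum_v taylor u v * taylor v w = 0.
Proof.
have [sw|nw] := boolP (is_symbol T w); last first.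
  by rewrite big1 // => v _; rewrite (taylor_nsymb _ nw) mulr0.
under eq_bigr do rewrite -[taylor _ w]intz.
rewrite taylor_sum //; pose z v : int := (v == u)%:R.
have zE v : is_symbol T v -> taylor u v =
    \sum_(f in edges T :\: v) z (f |: v) * (sgn f v)%:~R.
  move=> sv; rewrite -taylor_sum // (bigD1 u) //= /z eqxx mul1r intz.
  by rewrite big1 ?addr0 // => x /negPf ->; rewrite mul0r.
pose a (e f : {set 'I_n}) := z (f |: (e |: w)) * (sgn f (e |: w) * sgn e w).
pose P (e f : {set 'I_n}) :=
  [&& e \in edges T, f \in edges T, e != f, e \notin w & f \notin w].
transitivity (\sum_e \sum_(f | P e f) a e f).
  rewrite big_mkcond; apply: eq_bigr => e _; rewrite inE.
  case: ifP => [/andP[ew eT]|h]; last first.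
    by rewrite big_pred0 // => f; apply/negP => /and5P[eT _ _ ew _]; rewrite eT ew in h.
  rewrite zE; last by rewrite /is_symbol subUset sub1set eT.
  rewrite mulr_suml; apply: eq_big => f.
    rewrite /P in_setD in_setU1 negb_or eT ew /= eq_sym.
    by case: (_ == _); rewrite /= ?andbF // andbC.
  by move=> _; rewrite /a !intz mulrA.
set S2 := LHS; have /eqP : S2 = - S2.
  rewrite /S2 {2}pair_big_dep -sumrN.
  rewrite (reindex (fun p : {set 'I_n} * {set 'I_n} => (p.2, p.1))) /=; last first.
    by exists (fun p : {set 'I_n} * {set 'I_n} => (p.2, p.1)); case.
  rewrite pair_big_dep /=; apply: eq_big => [[e f]|[e f]] /=.
    rewrite /P eq_sym; by case: (_ \in _); case: (_ \in _); case: (_ == _);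
      case: (_ \in _); case: (_ \in _).
  case/and5P => eT fT ne ew fw.
  by rewrite /a setUCA (sgn_swap fT eT) 1?eq_sym // mulrN.
by rewrite -addr_eq0 -mulr2n mulrn_eq0 /= => /eqP.
Qed.

(** Coning with apex e0 is a contracting homotopy. *)
Lemma simplex_exact (K : fieldType) (z : symb -> K) e0 : e0 \in edges T ->
  (forall v, ~~ is_symbol T v -> z v = 0) ->
  (forall w, \sum_v z v * (taylor v w)%:~R = 0) ->
  forall w : symb, z w = \sum_(v : symb)
    (if e0 \in v then (sgn e0 (v :\ e0))%:~R * z (v :\ e0) else 0) *
    (taylor v w)%:~R.
Proof.
move=> e0T z0 dz w; have [sw|nw] := boolP (is_symbol T w); last first.
  by rewrite z0 // big1 // => v _; rewrite taylor_nsymb ?mulr0.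
rewrite (taylor_sum _ sw); have [e0w|e0w] := boolP (e0 \in w); last first.
  rewrite (bigD1 e0) /=; last by rewrite in_setD e0w.
  rewrite setU11 setU1K // [X in _ + X]big1 ?addr0.
    by rewrite mulrAC -intrM sgn_sq mul1r.
  by move=> f /andP[_ ne]; rewrite !inE eq_sym (negPf ne) (negPf e0w) mul0r.
have [w' [ew e0w' sw']] : exists w', [/\ w = e0 |: w', e0 \notin w' & is_symbol T w'].
  exists (w :\ e0); split; first by rewrite setD1K.
    by rewrite !inE eqxx.
  by apply: subset_trans sw; exact: subsetDl.
have := dz w'; rewrite taylor_sum // (bigD1 e0) /=; last by rewrite in_setD e0w'.
rewrite -ew => /eqP; rewrite addr_eq0 => /eqP.
move=> /(congr1 ( *%R^~ (sgn e0 w')%:~R)); rewrite -mulrA -intrM sgn_sq mulr1 => ->.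
rewrite mulNr mulr_suml -sumrN; apply: eq_big => f.
  by rewrite ew !in_setD in_setU1 negb_or -andbA; case: (f == e0); rewrite ?andbF //= ?andbT.
case/andP => /setDP[fT fw'] ne.
have e0f : e0 \in f |: w by rewrite ew !inE eqxx orbT.
have -> : (f |: w) :\ e0 = f |: w'.
  apply/setP => x; rewrite ew !inE; case: eqP => //= ->.
  by rewrite eq_sym (negPf ne) (negPf e0w').
have h : sgn e0 (f |: w') * sgn f w = - (sgn f w' * sgn e0 w').
  have -> : sgn e0 (f |: w') * sgn f w
      = sgn e0 (f |: w') * sgn f w' * (sgn f w' * sgn f w).
    by rewrite -mulrA (mulrA (sgn f w')) sgn_sq mul1r.
  rewrite sgn_swap // 1?eq_sym // -ew mulNr [sgn f w * _]mulrC -mulrA.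
  by rewrite (mulrCA (sgn f w)) sgn_sq mulr1 mulrC.
by rewrite e0f -!mulrA [RHS]mulrCA -!intrM h -mulrN rmorphN.
Qed.

End Taylor.

Lemma mcoeffMX_sub (n : nat) (K : fieldType) (p : {mpoly K[n]}) k m :
  (p * 'X_[k])@_m = if (k <= m)%MM then p@_(m - k) else 0.
Proof.
case: ifP => [le|/negP nle].
  by rewrite -{1}(submK le) addmC mcoeffMX.
apply: memN_msupp_eq0; rewrite (perm_mem (msuppMX _ _)).
by apply/negP => /mapP[m' _ e]; apply: nle; rewrite e lem_addr.
Qed.

Section Ideals.

Context (n : nat) (K : fieldType).
Local Notation R := {mpoly K[n]}.

Lemma ideal_gen0 (J : finType) (g : J -> R) : ideal_gen g 0.
Proof. by exists (fun=> 0); rewrite big1 // => j _; rewrite mul0r. Qed.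

Lemma ideal_genD (J : finType) (g : J -> R) p q :
  ideal_gen g p -> ideal_gen g q -> ideal_gen g (p + q).
Proof.
move=> [c ->] [c' ->]; exists (fun j => c j + c' j).
by rewrite -big_split; apply: eq_bigr => j _; rewrite mulrDl.
Qed.

Lemma ideal_genM (J : finType) (g : J -> R) p q :
  ideal_gen g q -> ideal_gen g (p * q).
Proof.
move=> [c ->]; exists (fun j => p * c j).
by rewrite mulr_sumr; apply: eq_bigr => j _; rewrite mulrA.
Qed.

Lemma ideal_gen_sum (J I : finType) (g : J -> R) (F : I -> R) :
  (forall i, ideal_gen g (F i)) -> ideal_gen g (\sum_i F i).
Proof.
move=> h; apply: (big_ind (ideal_gen g)) => //.
- exact: ideal_gen0.
- exact: ideal_genD.
Qed.

Lemma ideal_gen_gen (J : finType) (g : J -> R) j : ideal_gen g (g j).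
Proof.
exists (fun k => (k == j)%:R); rewrite (bigD1 j) //= eqxx mul1r big1 ?addr0 //.
by move=> k /negPf ->; rewrite mul0r.
Qed.

Lemma ideal_gen_monomial (J : finType) (e : J -> 'X_{1..n}) j m :
  (e j <= m)%MM -> ideal_gen (fun j => 'X_[K, e j]) 'X_[m].
Proof.
move=> le; rewrite -(submK le) mpolyXD; apply: ideal_genM.
exact: (ideal_gen_gen (fun j => 'X_[K, e j])).
Qed.

Lemma monomial_ideal_msupp (J : finType) (e : J -> 'X_{1..n}) p m :
  ideal_gen (fun j => 'X_[K, e j]) p -> m \in msupp p ->
  exists j, (e j <= m)%MM.
Proof.
move=> [c ->]; rewrite mcoeff_msupp raddf_sum /= => h.
have [j ej|no] := pickP (fun j => (e j <= m)%MM); first by exists j.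
by move: h; rewrite big1 ?eqxx // => j _; rewrite mcoeffMX_sub no.
Qed.

End Ideals.

Section TaylorResolution.

Context (n : nat) (T : rel 'I_n) (s : seq 'I_n) (K : fieldType).
Local Notation R := {mpoly K[n]}.
Local Notation symb := {set {set 'I_n}}.

(** The matrix of multidegree zero, for the grading by gr, with scalar entries c. *)
Definition homogenize (c : symb -> symb -> int) (u v : symb) : R :=
  (c u v)%:~R * 'X_[gr u - gr v].

Lemma submK2 (a b c : 'X_{1..n}) : (a <= b)%MM -> (b <= c)%MM ->
  (c - b + (b - a))%MM = (c - a)%MM.
Proof.
move=> /mnm_lepP ab /mnm_lepP bc; apply/mnmP => i; rewrite !mnmE.
by rewrite addnBA // subnK.
Qed.

Lemma submB2 (a b c : 'X_{1..n}) : (a <= b)%MM -> (b <= c)%MM ->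
  (c - a - (b - a))%MM = (c - b)%MM.
Proof.
move=> /mnm_lepP ab /mnm_lepP bc; apply/mnmP => i; rewrite !mnmE.
by rewrite subnBA // subnK // (leq_trans (ab i)).
Qed.

Lemma homogenize_comp (c c' : symb -> symb -> int) u w :
  (forall v, c u v != 0 -> (gr v <= gr u)%MM) ->
  (forall v, c' v w != 0 -> (gr w <= gr v)%MM) ->
  \sum_v homogenize c u v * homogenize c' v w =
  homogenize (fun u w => \sum_v c u v * c' v w) u w.
Proof.
move=> h h'; rewrite /homogenize rmorph_sum mulr_suml; apply: eq_bigr => v _.
have [->|/h le] := eqVneq (c u v) 0; first by rewrite !mul0r.
have [->|/h' le'] := eqVneq (c' v w) 0; first by rewrite mulr0 !mul0r mulr0.
by rewrite mulrACA -mpolyXD submK2 // rmorphM.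
Qed.

Lemma taylor_gr v w : taylor T s v w != 0 -> (gr w <= gr v)%MM.
Proof.
rewrite /taylor; case: ifP => // /facetP[_ [e [_ _ ->]]] _.
have := gr_U1 e w (gr (e |: w)); rewrite lepm_refl => /esym/andP[].
by [].
Qed.

(** The part of a chain in multidegree a, as a chain with coefficients in K. *)
Definition strand (a : 'X_{1..n}) (z : symb -> R) (u : symb) : K :=
  if (gr u <= a)%MM then (z u)@_(a - gr u) else 0.

Local Notation taylorR := (homogenize (taylor T s)).

Lemma strand_taylor a z w :
  \sum_v strand a z v * (taylor T s v w)%:~R =
  strand a (fun w => \sum_v z v * taylorR v w) w.
Proof.
rewrite /strand; case: ifP => le; last first.
  apply: big1 => v _; have [->|/taylor_gr le'] := eqVneq (taylor T s v w) 0.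
    by rewrite mulr0.
  by case: ifP => [/(lepm_trans le')|]; rewrite ?le // mul0r.
rewrite raddf_sum; apply: eq_bigr => v _ /=.
have [e|/taylor_gr le'] := eqVneq (taylor T s v w) 0.
  by rewrite /homogenize e mul0r !mulr0 mcoeff0.
rewrite /homogenize mulrCA mulrzl raddfMz /= mcoeffMX_sub mulrzr.
have -> : (gr v - gr w <= a - gr w)%MM = (gr v <= a)%MM.
  apply/mnm_lepP/mnm_lepP => h i; move: (h i); rewrite ?mnmE; last exact: leq_sub2r.
  by rewrite leq_subLR subnKC //; move/mnm_lepP: le.
by case: ifP => [le2|_]; [rewrite (submB2 le' le2)|].
Qed.

(** A preimage of a strand that is a cycle: the cone over an edge dividing a.  If no
    edge divides a, such a strand can only live at the empty symbol, where the
    hypothesis of [taylor_exact] makes it zero. *)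
Definition strand_cone (a : 'X_{1..n}) (z : symb -> R) (v : symb) : K :=
  if [pick e in edges T | (edge_mon e <= a)%MM] is Some e then
    if e \in v then (sgn T s e (v :\ e))%:~R * strand a z (v :\ e) else 0
  else 0.

Lemma strand_cone_eq0 a z v : ~~ (gr v <= a)%MM -> strand_cone a z v = 0.
Proof.
rewrite /strand_cone; case: pickP => // e /andP[eT ea]; case: ifP => // ev.
rewrite -{1}(setD1K ev) gr_U1 ea /= => nle.
by rewrite /strand (negPf nle) mulr0.
Qed.

Lemma strand_exact a (z : symb -> R) w :
  (forall v, ~~ is_symbol T v -> z v = 0) ->
  (forall w, \sum_v z v * taylorR v w = 0) ->
  edge_ideal T (z set0) ->
  strand a z w = \sum_v strand_cone a z v * (taylor T s v w)%:~R.
Proof.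
move=> z0 dz Iz; rewrite /strand_cone; case: pickP => [e /andP[eT ea]|no].
  apply: simplex_exact => //.
    by move=> v /z0 e0; rewrite /strand e0 mcoeff0 if_same.
  by move=> x; rewrite strand_taylor /strand dz mcoeff0 if_same.
rewrite [RHS]big1 => [|v _]; last by rewrite mul0r.
rewrite /strand; case: ifP => // le.
have [->|[e ew]] := set_0Vmem w.
  rewrite gr0; apply: memN_msupp_eq0; apply/negP => /(monomial_ideal_msupp Iz)[[e eT]] /= h.
  have := no e; rewrite eT /= => /negP; apply; apply: lepm_trans h _.
  exact: lem_subr.
have [sw|/z0->] := boolP (is_symbol T w); last by rewrite mcoeff0.
have := no e; rewrite (subsetP sw) //=; move: le.
by rewrite -{1}(setD1K ew) gr_U1 => /andP[->].
Qed.

(** Only finitely many multidegrees occur in z; the preimages of the strands add up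
    to a preimage of z. *)
Lemma taylor_exact (z : symb -> R) :
  (forall v, ~~ is_symbol T v -> z v = 0) ->
  (forall w, \sum_v z v * taylorR v w = 0) ->
  edge_ideal T (z set0) ->
  exists y : symb -> R, forall w, z w = \sum_v y v * taylorR v w.
Proof.
move=> z0 dz Iz.
pose A := undup (flatten [seq [seq (m + gr u)%MM | m <- msupp (z u)] | u : symb]).
have memA u m : m \in msupp (z u) -> (m + gr u)%MM \in A.
  move=> mz; rewrite mem_undup; apply/flattenP.
  exists [seq (m + gr u)%MM | m <- msupp (z u)]; last exact: map_f.
  by apply/imageP; exists u.
exists (fun v => \sum_(a <- A) strand_cone a z v *: 'X_[a - gr v]) => w.
transitivity (\sum_(a <- A) strand a z w *: 'X_[a - gr w]).
  apply/mpolyP => m; rewrite raddf_sum /=.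
  have h a : (strand a z w *: 'X_[a - gr w])@_m =
      if a == (m + gr w)%MM then (z w)@_m else 0.
    rewrite mcoeffZ mcoeffX /strand; case: (boolP (gr w <= a)%MM) => le.
      rewrite -(eqm_add2r (gr w)) submK //; case: eqP => [->|]; last by rewrite mulr0.
      by rewrite addmK mulr1.
    by rewrite mul0r; case: eqP le => // ->; rewrite lem_addl.
  under eq_bigr do rewrite h.
  rewrite -big_mkcond; have [mA|mA] := boolP ((m + gr w)%MM \in A).
    by rewrite -big_filter filter_pred1_uniq ?undup_uniq // big_seq1.
  rewrite big_seq_cond big_pred0; last first.
    by move=> a; apply/negP => /andP[aA /eqP e]; rewrite -e aA in mA.
  by apply: memN_msupp_eq0; apply: contra mA => /memA.
under [RHS]eq_bigr do rewrite mulr_suml.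
rewrite exchange_big; apply: eq_bigr => a _.
rewrite strand_exact // scaler_suml; apply: eq_bigr => v _; rewrite /homogenize.
have [->|/taylor_gr le] := eqVneq (taylor T s v w) 0.
  by rewrite mul0r !mulr0 scale0r.
have [le'|/strand_cone_eq0 ->] := boolP (gr v <= a)%MM; last by rewrite mul0r !scale0r mul0r.
by rewrite mulrCA -scalerAl -mpolyXD submK2 // mulrzl mulrzr scalerMzl.
Qed.

End TaylorResolution.

(** * The Morse complex of the edge ideal *)

Section MorseComplex.

Context (K : fieldType) (n : nat) (T : rel 'I_n) (x1 : 'I_n) (s : seq 'I_n).
Context (tree_T : is_tree T) (listing_s : rank_listing T x1 s).
Local Notation symb := {set {set 'I_n}}.
Local Notation R := {mpoly K[n]}.
Implicit Types u v a b c : symb.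

Let size_symb u := #|u|.

Local Notation tau := (toggle T s).
Local Notation critical := (critical tau).
Local Notation lower := (lower size_symb tau).
Local Notation upper := (upper size_symb tau).
Local Notation gps := (grad_path_sum T s).

Let T_sym : ssrbool.symmetric T. Proof. by case: tree_T. Qed.
Let T_irr : irreflexive T. Proof. by case: tree_T. Qed.
Let vgt_tot : forall x y : 'I_n, x != y -> vgt s x y || vgt s y x.
Proof. exact: vgt_total listing_s. Qed.
Let parent_inj : forall x y z, parent T s x z -> parent T s y z -> x = y.
Proof.
move=> x y z /andP[xz xz'] /andP[yz yz'].
exact: (parent_unique tree_T listing_s xz yz xz' yz').
Qed.

Let tauK : involutive tau. Proof. exact: toggleK. Qed.
Let tau_size a : size_symb (tau a) = size_symb a -> tau a = a.
Proof. exact: toggle_card. Qed.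

Let matchE a b : matching T s a b = (tau b == a) && (#|b| < #|a|)%N.
Proof. exact: matching_toggle. Qed.

Lemma matching_lower a b : matching T s a b = lower b && (a == tau b).
Proof. by rewrite matchE eq_sym andbC /lower; case: eqP => [->|]; rewrite ?andbF. Qed.

Lemma lower_facet a : lower a -> facet T (tau a) a.
Proof.
move=> la; have : matching T s (tau a) a by rewrite matching_lower la eqxx.
by case/and3P.
Qed.

Lemma facet_card a b : facet T a b -> #|a| = #|b|.+1.
Proof. by case/and4P => _ _ _ /eqP. Qed.

Lemma flow_rank_facet u b : upper u -> lower b -> b != tau u -> facet T u b ->
  (flow_rank T s b < flow_rank T s (tau u))%N.
Proof.
move=> uu lb ne ub; apply: (flow_rank_lt T_sym T_irr vgt_tot).
have [us [e [pe eu ue]]] : is_symbol T (tau u) /\ exists mu,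
    [/\ pivot T s (tau u) = Some mu, mu \notin tau u & tau (tau u) = mu |: tau u].
  by apply: toggle_lower; rewrite tauK.
rewrite tauK in ue.
have [bs [f [fT fb ub']]] := facetP _ _ _ ub.
have [_ [g [pg gb _]]] := toggle_lower lb.
have bE : b = (e |: tau u) :\ f by rewrite -ue ub' setU1K.
have fe : f != e.
  by apply: contraNneq ne => fe; rewrite bE fe setU1K.
rewrite bE in pg gb *; apply: (gradient_step_precedes T_sym T_irr vgt_tot us pe eu fT fe _ pg gb).
have : f \in e |: tau u by rewrite -ue ub' setU11.
by rewrite in_setU1 (negPf fe).
Qed.

(** An upper symbol counts with the size of its partner, so that no gradient step
    raises the level. *)
Definition level u : nat := if upper u then #|u|.-1 else #|u|.

(** On a fixed level, a gradient path goes from a lower symbol to its partner, and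
    from there to a lower symbol of smaller rank or to a critical one. *)
Definition stage u : nat :=
  if lower u then (flow_rank T s u).*2.+2
  else if upper u then (flow_rank T s (tau u)).*2.+1 else 0.

(** Lexicographic in level and stage, as the factor exceeds every stage. *)
Definition step_rank u : nat := (level u * (#|{: symb}|.*2 + 3) + stage u)%N.

Lemma stage_lt u : (stage u < #|{: symb}|.*2 + 3)%N.
Proof.
have h v : (flow_rank T s v <= #|{: symb}|)%N by exact: max_card.
by rewrite /stage; case: ifP => _; [|case: ifP => _ //]; have := h u; have := h (tau u); lia.
Qed.

Lemma step_rank_lex u v : (level v < level u)%N ||
    (level v == level u) && (stage v < stage u)%N ->
  (step_rank v < step_rank u)%N.
Proof.
rewrite /step_rank; have := stage_lt v; move: (#|_|.*2 + 3)%N => M h.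
case/orP => [lt|/andP[/eqP -> lt]]; last by rewrite ltn_add2l.
apply: (@leq_trans (level v * M + M)); first by rewrite ltn_add2l.
by apply: leq_trans (leq_addr _ _); rewrite addnC -mulSn leq_mul2r lt orbT.
Qed.

Lemma lower_upper a : lower a -> upper a = false.
Proof. by rewrite /lower /upper => h; rewrite ltnNge ltnW. Qed.

Lemma lower_card a : lower a -> #|tau a| = #|a|.+1.
Proof. by move=> la; apply: facet_card; exact: lower_facet. Qed.

Lemma grad_step_rank u v : grad_step T s u v -> (step_rank v < step_rank u)%N.
Proof.
case/orP => [/andP[fuv]|].
  rewrite matching_lower => nm; have cu := facet_card fuv.
  apply: step_rank_lex; rewrite /level.
  have lv : ((if upper v then #|v|.-1 else #|v|) <= #|v|)%N.
    by case: ifP => _ //; exact: leq_pred.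
  have [uu|nu] := boolP (upper u); last by rewrite cu ltnS lv.
  have lu : lower u = false.
    by apply/negbTE/negP => /lower_upper; rewrite uu.
  have [uv|nv] := boolP (upper v).
    have : (0 < #|v|)%N by move: uv; apply: leq_ltn_trans.
    by rewrite cu; case: #|v| => // m _; rewrite ltnSn.
  rewrite cu eqxx ltnn /= /stage lu uu.
  have [lv'|nlv] := boolP (lower v); last by rewrite (negPf nv).
  have ne : v != tau u.
    by apply: contraNneq nm => ->; rewrite tauK eqxx lower_tau ?uu.
  by have := flow_rank_facet uu lv' ne fuv; lia.
rewrite matching_lower => /andP[lu /eqP ->].
apply: step_rank_lex; rewrite /level (lower_upper lu).
have ut : upper (tau u) by rewrite upper_tau.
rewrite ut lower_card // eqxx ltnn /= /stage lu ut tauK.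
by rewrite lower_tau // (lower_upper lu) ltnSn.
Qed.

Lemma path_weightE a b :
  (if grad_step T s a b then step_weight T s a b else 0) =
  taylor T s a b - (if lower b && (a == tau b) then taylor T s a b else 0)
   - (if lower a && (b == tau a) then taylor T s b a else 0).
Proof.
rewrite /grad_step /step_weight !matching_lower /taylor.
have [/andP[la /eqP ->]|nm] := boolP (lower a && (b == tau a)).
  have fba := lower_facet la; rewrite fba orbT.
  rewrite ifN; first by rewrite if_same subr0 sub0r.
  by apply/negP => /facet_card; rewrite lower_card // => /eqP; lia.
rewrite orbF subr0; have [ab|nab] := boolP (facet T a b); last by rewrite if_same subr0.
by case: (lower b && _); rewrite /= ?subrr ?subr0.
Qed.

Lemma gps_rec a c :
  gps a c = (a == c)%:R + \sum_b taylor T s a b * gps b c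
   - (if upper a then taylor T s a (tau a) * gps (tau a) c else 0)
   - (if lower a then taylor T s (tau a) a * gps (tau a) c else 0).
Proof.
rewrite (grad_path_sumS a c grad_step_rank) -!addrA; congr (_ + _).
rewrite big_mkcond.
transitivity (\sum_b (taylor T s a b * gps b c
   - (if lower b && (a == tau b) then taylor T s a b * gps b c else 0)
   - (if lower a && (b == tau a) then taylor T s b a * gps b c else 0))).
  apply: eq_bigr => b _; have := path_weightE a b.
  do 3 case: ifP => _; rewrite ?subr0 ?mul0r; move=> h.
  all: rewrite -?mulrBl -?h ?mul0r //.
rewrite !sumrB -!addrA; congr (_ + (- _ - _)).
  rewrite (bigD1 (tau a)) //= lower_tau // tauK eqxx andbT big1 ?addr0 //.
  move=> b ne; suff /negPf -> : a != tau b by rewrite andbF.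
  by apply: contraNneq ne => ->; rewrite tauK.
rewrite (bigD1 (tau a)) //= eqxx andbT big1 ?addr0 //.
by move=> b /negPf ->; rewrite andbF.
Qed.

(** A step up leads to an upper symbol, from which only steps down start; so a path
    that begins below the size of c, or at an upper symbol of that size, goes on
    like that and misses the critical symbol c. *)
Lemma gps_small a c : critical c ->
  (#|a| < #|c|)%N || (#|a| == #|c|) && upper a -> gps a c = 0.
Proof.
move=> cc bad; apply: grad_path_sum_eq0 => p; elim: p a bad => [|b p IH] a /= bad.
  move=> _; apply: contraTneq bad => ->.
  by rewrite ltnn eqxx /=; apply/negP => /upper_crit; rewrite cc.
case/andP => st; apply: IH; case/orP: st => [/andP[/facet_card e _]|].
  by apply/orP; left; move: bad; rewrite e => /orP[/ltnW|/andP[/eqP <- _]].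
rewrite matching_lower => /andP[la /eqP ->]; rewrite upper_tau // la andbT lower_card //.
by move: bad; rewrite (lower_upper la) andbF orbF leq_eqVlt orbC.
Qed.

Lemma grad_step_symbol a b : grad_step T s a b -> is_symbol T b.
Proof. by case/orP => [/andP[/and4P[]]|/and3P[/and4P[]]]. Qed.

Lemma grad_step_cover a b : grad_step T s a b -> cover b \subset cover a.
Proof.
case/orP => [/andP[/and4P[_ _ ba _] _]|].
  by apply/bigcupsP => mu mub; apply: bigcup_sup; exact: (subsetP ba).
by rewrite matching_lower => /andP[_ /eqP ->]; rewrite toggle_cover.
Qed.

Lemma gps_gr a c : gps a c != 0 -> (gr c <= gr a)%MM.
Proof.
rewrite gr_le; apply: contraNT => h; apply/eqP; apply: grad_path_sum_eq0 => p.
elim: p a h => [|b p IH] a h /=; first by move=> _; apply: contraNneq h => ->.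
case/andP => /grad_step_cover ba; apply: IH; apply: contra h => h; exact: subset_trans h ba.
Qed.

Lemma gps_nonsymbol a c : is_symbol T a -> ~~ is_symbol T c -> gps a c = 0.
Proof.
move=> sa nc; apply: grad_path_sum_eq0 => p; elim: p a sa => [|b p IH] a sa /=.
  by move=> _; apply: contraNneq nc => <-.
by case/andP => /grad_step_symbol; exact: IH.
Qed.

Local Notation dR := (homogenize K (taylor T s)).
Local Notation GR := (homogenize K gps).

Lemma dR_neq0 a b : dR a b != 0 -> facet T a b.
Proof.
by apply: contraNT => nf; rewrite /homogenize /taylor (negPf nf) mul0r.
Qed.

Lemma dR_size u v : dR u v != 0 -> size_symb u = (size_symb v).+1.
Proof. by move/dR_neq0/facet_card. Qed.

Lemma dR_dR u w : \sum_v dR u v * dR v w = 0.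
Proof.
rewrite homogenize_comp; try by move=> v; exact: taylor_gr.
by rewrite /homogenize taylor_taylor mul0r.
Qed.

Lemma gr_tau a : gr (tau a) = gr a.
Proof. by apply/mnmP => i; rewrite !grE toggle_cover. Qed.

Lemma dR_lower a : lower a -> dR (tau a) a = (taylor T s (tau a) a)%:~R.
Proof.
move=> la; rewrite /homogenize gr_tau (_ : (_ - _)%MM = 0%MM) ?mpolyX0 ?mulr1 //.
by apply/mnmP => i; rewrite !mnmE subnn.
Qed.

Lemma dR_unit a : lower a -> dR (tau a) a * dR (tau a) a = 1.
Proof.
move=> la; rewrite dR_lower // -intrM /taylor lower_facet //.
by rewrite -expr2 sqrr_sign.
Qed.

Lemma sum_dR_GR a c : \sum_b dR a b * GR b c =
  (\sum_b taylor T s a b * gps b c)%:~R * 'X_[gr a - gr c].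
Proof.
rewrite homogenize_comp //; first by move=> b; exact: taylor_gr.
by move=> b; exact: gps_gr.
Qed.

Lemma GR_lower a c : critical c -> lower a ->
  GR a c = \sum_b dR a b * GR b c - dR (tau a) a * GR (tau a) c.
Proof.
move=> cc la; rewrite sum_dR_GR dR_lower // /homogenize gr_tau mulrA -intrM.
rewrite -mulrBl -rmorphB; congr (_%:~R * _); rewrite gps_rec la (lower_upper la) subr0.
case: eqP => [ac|_]; last by rewrite add0r.
by move: la; rewrite ac => /lower_crit; rewrite cc.
Qed.

Lemma GR_upper a c : critical c -> upper a ->
  GR a c = \sum_b dR a b * GR b c - dR a (tau a) * GR (tau a) c.
Proof.
move=> cc ua; have lt : lower (tau a) by rewrite lower_tau.
have := dR_lower lt; rewrite tauK => ->.
rewrite sum_dR_GR /homogenize gr_tau mulrA -intrM.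
rewrite -mulrBl -rmorphB; congr (_%:~R * _); rewrite gps_rec ua.
have -> : lower a = false by apply/negbTE/negP => /lower_upper; rewrite ua.
rewrite subr0; case: eqP => [ac|_]; last by rewrite add0r.
by move: ua; rewrite ac => /upper_crit; rewrite cc.
Qed.

Lemma GR_crit a c : critical c -> critical a ->
  GR a c = (a == c)%:R + \sum_b dR a b * GR b c.
Proof.
move=> cc /eqP ca; rewrite sum_dR_GR /homogenize gps_rec.
rewrite /upper /lower ca ltnn !subr0 rmorphD mulrDl; congr (_ + _).
case: eqP => [->|_]; last by rewrite mul0r.
rewrite (_ : (_ - _)%MM = 0%MM) ?mpolyX0 ?mulr1 //.
by apply/mnmP => i; rewrite !mnmE subnn.
Qed.

Lemma GR_small a c : critical c -> (size_symb a < size_symb c)%N -> GR a c = 0.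
Proof. by move=> cc lt; rewrite /homogenize gps_small ?mul0r // lt. Qed.

Lemma GR_upper0 a c : critical c -> upper a -> size_symb a = size_symb c -> GR a c = 0.
Proof.
move=> cc ua e; have e' : #|a| = #|c| := e.
by rewrite /homogenize gps_small ?mul0r // e' eqxx ua orbT.
Qed.

Lemma flow_rank_dR u b : upper u -> lower b -> b != tau u -> dR u b != 0 ->
  (flow_rank T s b < flow_rank T s (tau u))%N.
Proof. by move=> uu lb ne /dR_neq0; exact: flow_rank_facet. Qed.

Let flow_boundaryR := @flow_boundary _ _ size_symb dR tau GR (flow_rank T s)
  dR_size dR_dR tauK tau_size dR_unit GR_lower GR_upper GR_crit GR_small GR_upper0
  flow_rank_dR.

Let cycle_liftR := @critical_cycle_lift _ _ size_symb dR tau GR (flow_rank T s)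
  dR_size dR_dR tauK tau_size dR_unit GR_lower GR_upper GR_crit GR_small GR_upper0
  flow_rank_dR.

Let morse_diff_compR := @morse_diff_comp _ _ size_symb dR tau GR (flow_rank T s)
  dR_size dR_dR tauK tau_size dR_unit GR_lower GR_upper GR_crit GR_small GR_upper0
  flow_rank_dR.

Local Notation basis := (F_basis T s).
Local Notation mdR := (morse_diff dR GR).

Lemma morse_coefE a c : morse_coef T s a c = \sum_b taylor T s a b * gps b c.
Proof.
rewrite /morse_coef big_mkcond; apply: eq_bigr => b _; rewrite /taylor.
by case: ifP => _ //; rewrite mul0r.
Qed.

Lemma F_diffE r (u : basis r.+1) (v : basis r) :
  F_diff K u v = mdR (val u) (val v).
Proof. by rewrite /F_diff morse_coefE -sum_dR_GR. Qed.

Lemma basisP r (b : basis r) : [/\ is_symbol T (val b), critical (val b) & #|val b| = r].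
Proof.
have := valP b; rewrite (F_admissibleE T_sym T_irr vgt_tot parent_inj).
by case/andP => /andP[] ? ? /eqP.
Qed.

Lemma basis_exists u : is_symbol T u -> critical u -> exists b : basis #|u|, val b = u.
Proof.
move=> us cu; have h : F_admissible T s u && (#|u| == #|u|).
  by rewrite (F_admissibleE T_sym T_irr vgt_tot parent_inj) us eqxx andbT.
by exists (exist _ u h).
Qed.

Definition extend r (f : {ffun basis r -> R}) (u : symb) : R :=
  oapp f 0 (insub u).

Lemma extend_val r (f : {ffun basis r -> R}) (b : basis r) : extend f (val b) = f b.
Proof. by rewrite /extend valK. Qed.

Lemma extend_neq0 r (f : {ffun basis r -> R}) u : extend f u != 0 ->
  [/\ is_symbol T u, critical u & #|u| = r].
Proof.
by rewrite /extend; case: insubP => [b _ <- _|_]; [exact: basisP|rewrite eqxx].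
Qed.

Lemma mdR_nonsymbol_l u c : ~~ is_symbol T u -> mdR u c = 0.
Proof.
move=> nu; apply: big1 => b _; rewrite /homogenize /taylor.
by case: ifP => [/and4P[us]|_]; [rewrite us in nu|rewrite mul0r mul0r].
Qed.

Lemma mdR_nonsymbol_r u c : ~~ is_symbol T c -> mdR u c = 0.
Proof.
move=> nc; apply: big1 => b _; rewrite /homogenize /taylor.
case: ifP => [/and4P[_ us _ _]|_]; last by rewrite mul0r mul0r.
by rewrite gps_nonsymbol // mul0r mulr0.
Qed.

Lemma sum_basis r c (F : symb -> R) :
  \sum_(b : basis r) F (val b) * mdR (val b) c =
  \sum_(u | critical u && (#|u| == r)) F u * mdR u c.
Proof.
transitivity (\sum_(u | F_admissible T s u && (#|u| == r)) F u * mdR u c).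
  exact: (esym (big_sub [pred u | F_admissible T s u && (#|u| == r)] _)).
rewrite big_mkcond [RHS]big_mkcond; apply: eq_bigr => u _.
rewrite (F_admissibleE T_sym T_irr vgt_tot parent_inj).
have [us|nu] := boolP (is_symbol T u) => //=.
by rewrite mdR_nonsymbol_l // mulr0 if_same.
Qed.

Lemma sum_extend r c (f : {ffun basis r -> R}) :
  \sum_b f b * mdR (val b) c =
  \sum_(u | critical u && (#|u| == r)) extend f u * mdR u c.
Proof. by rewrite -sum_basis; apply: eq_bigr => b _; rewrite extend_val. Qed.

(** Lift the cycle to the Taylor complex, fill it there, and project back. *)
Lemma cycle_is_boundary r (f : {ffun basis r -> R}) :
  (forall c, critical c ->
     \sum_(u | critical u && (#|u| == #|c|.+1)) extend f u * mdR u c = 0) ->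
  edge_ideal T (extend f set0) -> exists g, f = free_map (@F_diff n T s K r) g.
Proof.
move=> cyc I0; have f0 v : ~~ critical v -> extend f v = 0.
  by apply: contraNeq => /extend_neq0[].
have [k [k0 dz fz]] := cycle_liftR f0 cyc.
have crit0 : critical set0.
  apply/eqP/tau_size; have := toggle_cover T_sym T_irr vgt_tot set0.
  rewrite /size_symb cards0 /cover big_set0 => c0; apply/eqP.
  rewrite cards_eq0; apply: contraT => /set0Pn[mu]; rewrite /toggle.
  rewrite /is_symbol sub0set; case e: (pivot T s set0) => [e0|]; last by rewrite inE.
  have [/edge_toggleableP[x [z [_ /toggleableP[_ [w [_ zw _]] _]]]] _] :=
    pivotP T_sym T_irr vgt_tot set0 e0 (introT eqP e).
  by rewrite inE in zw.
have [y yE] : exists y : symb -> R,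
    forall w, extend f w - k w = \sum_v y v * dR v w.
  apply: taylor_exact => //.
    move=> v nv; rewrite k0; last first.
      by rewrite /upper /toggle (negPf nv) ltnn.
    by rewrite subr0; apply/eqP; apply: contraNT nv => /extend_neq0[].
  by rewrite k0 ?subr0 // /upper (eqP crit0) ltnn.
exists [ffun b => flow size_symb GR y (val b)]; apply/ffunP => v; rewrite ffunE.
have [vs cv sv] := basisP v.
rewrite -extend_val -fz //.
transitivity (flow size_symb GR (boundary dR y) (val v)).
  by apply: eq_bigr => a _; rewrite yE.
rewrite flow_boundaryR // /size_symb sv -sum_basis.
by apply: eq_bigr => b _; rewrite ffunE F_diffE.
Qed.

Lemma diff_diff r (u : basis r.+2) (w : basis r) :
  \sum_v F_diff K u v * F_diff K v w = 0.
Proof.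
have [_ cu su] := basisP u; have [_ cw sw] := basisP w.
under eq_bigr do rewrite !F_diffE.
rewrite (sum_basis _ _ (mdR (val u))); have := morse_diff_compR cu cw.
by rewrite /size_symb su sw; apply.
Qed.

(** A nonzero entry comes from a gradient path that starts at a facet, and
    multidegrees do not grow along it. *)
Lemma F_diff_gr r (u : basis r.+1) (v : basis r) : F_diff K u v != 0 ->
  exists2 u' : symb, facet T (val u) u' & (gr (val v) <= gr u')%MM.
Proof.
rewrite F_diffE /morse_diff => h.
have [/existsP[u' /andP[h1 h2]]|no] :=
    boolP [exists b, (dR (val u) b != 0) && (GR b (val v) != 0)].
  exists u'; first exact: dR_neq0.
  by apply: gps_gr; apply: contraNneq h2 => e; rewrite /homogenize e mul0r.
case/eqP: h; apply: big1 => b _; move/existsP: no => no.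
have [->|h1] := eqVneq (dR (val u) b) 0; first by rewrite mul0r.
have [->|h2] := eqVneq (GR b (val v)) 0; first by rewrite mulr0.
by case: no; exists b; rewrite h1.
Qed.

Lemma facet_gr u u' : facet T u u' -> (gr u' <= gr u)%MM.
Proof.
case/and4P => _ _ h _; rewrite gr_le; apply/bigcupsP => mu mub.
by apply: bigcup_sup; exact: (subsetP h).
Qed.

(** A facet loses an endpoint of the removed edge that lies in no other member, so
    the exponent of that variable drops. *)
Lemma F_diff_max_ideal r (u : basis r.+1) (v : basis r) :
  max_ideal (F_diff K u v).
Proof.
have [->|h] := eqVneq (F_diff K u v) 0; first exact: ideal_gen0.
have [u' fu gu] := F_diff_gr h; have [us cu _] := basisP u.
have [us' [e [eT eu ue]]] := facetP _ _ _ fu.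
have pu : pivot T s (val u) = None.
  by apply: (admissible_no_pivot T_sym T_irr vgt_tot parent_inj); case/andP: (valP u).
have eu' : e \in val u by rewrite ue setU11.
have [i ie ip] := private_endpoint T_sym T_irr vgt_tot parent_inj us pu eu'.
apply: ideal_genM; apply: (@ideal_gen_monomial _ _ _ (fun i : 'I_n => U_(i)%MM) i).
have gi : gr (val u) i = 1%N.
  by rewrite grE; apply/eqP; rewrite eqb1; apply/bigcupP; exists e.
have gi' : gr (val v) i = 0%N.
  apply/eqP; rewrite -leqn0; move/mnm_lepP: gu => /(_ i) /leq_trans; apply.
  rewrite leqn0 grE eqb0; apply/negP => /bigcupP[mu muu imu].
  have muu' : mu \in val u by rewrite ue in_setU1 muu orbT.
  by move: eu; rewrite -(ip mu muu' imu) muu.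
apply/mnm_lepP => j; rewrite mnm1E mnmE; case: eqP => // <-.
by rewrite gi gi'.
Qed.

Lemma F_diff_homogeneous r (u : basis r.+1) (v : basis r) m :
  m \in msupp (F_diff K u v) -> (m + gr (val v))%MM = gr (val u).
Proof.
move=> h; have nz : F_diff K u v != 0 by apply: contraTneq h => ->; rewrite msupp0.
have [u' fu gu] := F_diff_gr nz.
move: h; rewrite mcoeff_msupp /F_diff mulrzl raddfMz /= mcoeffX.
have [<- _|_] := eqVneq (gr (val u) - gr (val v))%MM m; last by rewrite mul0rz eqxx.
by rewrite submK // (lepm_trans gu) // facet_gr.
Qed.

Lemma basis0 (b : basis 0) : val b = set0.
Proof. by have [_ _ /eqP] := basisP b; rewrite cards_eq0 => /eqP. Qed.

Lemma basis0_exists : exists b : basis 0, forall b' : basis 0, b' = b.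
Proof.
have h : F_admissible T s set0 && (#|set0 : symb| == 0).
  rewrite cards0 eqxx andbT; apply/andP; split.
    apply/existsP; exists set0; rewrite sub0set andbT.
    by apply/forallP => x; rewrite inE.
  by apply/existsP => -[x /existsP[y /existsP[z /existsP[w /and3P[_]]]]]; rewrite inE.
by exists (exist _ set0 h) => b'; apply: val_inj; rewrite basis0.
Qed.

Lemma F_minimal_resolution :
  minimal_graded_free_resolution_of_quotient
    (@edge_ideal n T K) (@F_deg n T s) (@F_diff n T s K) (@F_aug n T s K).
Proof.
have [b0 b0P] := basis0_exists.
have aug f : free_aug (@F_aug n T s K) f = f b0.
  rewrite /free_aug (bigD1 b0) //= big1 ?addr0 ?mulr1 // => b.
  by rewrite (b0P b) eqxx.
split.
- move=> p; exists [ffun=> p]; rewrite aug ffunE subrr; exact: ideal_gen0.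
- move=> f; rewrite aug; split.
    move=> If; apply: cycle_is_boundary; last by rewrite -(basis0 b0) extend_val.
    move=> c cc; rewrite big1 // => u /andP[_ /eqP su].
    have [->|/extend_neq0[_ _]] := eqVneq (extend f u) 0; first by rewrite mul0r.
    by rewrite su.
  move=> [g ->]; rewrite ffunE; apply: ideal_gen_sum => b; apply: ideal_genM.
  have [bs _ sb] := basisP b.
  have /card_gt0P[e eb] : (0 < #|val b|)%N by rewrite sb.
  have eT : e \in edges T by exact: (subsetP bs).
  apply: ideal_genM; rewrite basis0 gr0 subm0.
  apply: (@ideal_gen_monomial _ _ _ (fun mu : {mu | mu \in edges T} => edge_mon (val mu))
    (exist _ e eT)) => /=.
  by have := gr_U1 e (val b :\ e) (gr (val b)); rewrite setD1K // lepm_refl => /esym/andP[].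
- move=> r f; split=> [f0|[g ->]].
    apply: cycle_is_boundary; last first.
      have [->|/extend_neq0[_ _]] := eqVneq (extend f set0) 0; first exact: ideal_gen0.
      by rewrite cards0.
    move=> c cc; have [sc|nc] := boolP (is_symbol T c); last first.
      by rewrite big1 // => u _; rewrite mdR_nonsymbol_r // mulr0.
    have [e|ne] := eqVneq #|c| r; last first.
      rewrite big1 // => u /andP[_ /eqP su].
      have [->|/extend_neq0[_ _]] := eqVneq (extend f u) 0; first by rewrite mul0r.
      by rewrite su => -[e]; rewrite e eqxx in ne.
    have [b bc] := basis_exists sc cc; move: b bc; rewrite e => b bc.
    have := congr1 (fun h : {ffun basis r -> R} => h b) f0; rewrite !ffunE.
    rewrite -bc -sum_extend => h; rewrite -[RHS]h.
    by apply: eq_bigr => u _; rewrite F_diffE.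
  apply/ffunP => w; rewrite !ffunE; under eq_bigr do rewrite ffunE mulr_suml.
  rewrite exchange_big big1 // => u _.
  by under eq_bigr do rewrite -mulrA; rewrite -mulr_sumr diff_diff mulr0.
- move=> a f hf m; rewrite aug => mf; have := hf b0 m mf.
  by rewrite /F_deg basis0 gr0 addm0.
- move=> r a f hf v m; rewrite ffunE mcoeff_msupp raddf_sum /= => h.
  have [/existsP[u hu]|no] := boolP [exists u, (f u * F_diff K u v)@_m != 0].
    move: hu; rewrite -mcoeff_msupp => /msuppM_le /allpairsP[[m1 m2] /= [h1 h2 ->]].
    by rewrite -addmA (F_diff_homogeneous h2); exact: hf.
  move: h; rewrite big1 ?eqxx // => u _; apply/eqP; apply: contraT => h.
  by move/existsP: no; case; exists u.
move=> r f v; rewrite ffunE; apply: ideal_gen_sum => u; apply: ideal_genM.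
exact: F_diff_max_ideal.
Qed.

End MorseComplex.

Theorem theorem3p17 (K : fieldType) (n : nat) (T : rel 'I_n) (x1 : 'I_n)
    (s : seq 'I_n) (tree_T : is_tree T) (listing_s : rank_listing T x1 s) :
  minimal_graded_free_resolution_of_quotient
    (@edge_ideal n T K) (@F_deg n T s) (@F_diff n T s K) (@F_aug n T s K).
Proof. exact: F_minimal_resolution tree_T listing_s. Qed.
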